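(* Let $m\ge2$ and $\alpha\le0$. Let $\Omega$ be a body in $\mathbb{R}^m$ whose complement satisfies the uniform boundary inner cone condition of aperture angle $\kappa$ and height $\delta$, where $0<\kappa\le\pi$ and $0<\delta\le+\infty$. Then any $r^{\alpha-m}$-center of $\Omega$ belongs to the intersection $(\Omega\sim\tilde R B^m)\cap Uf(\Omega)$, where $\tilde R=\tilde R(\alpha,\kappa,\delta,\operatorname{diam}\Omega,R_\infty(\Omega))$.
   Context: A body in $\mathbb{R}^m$ is the closure of a bounded open set. $\Omega^c$ is the complement, $B_\rho(x)$ the closed ball of radius $\rho$ centered at $x$, $\sigma$ the $(m-1)$-dimensional spherical Lebesgue measure, $R_\infty(\Omega)=\max_{\xi\in\Omega}\operatorname{dist}(\xi,\Omega^c)$ the inradius, and $\Omega\sim\rho B^m=\{x\in\Omega:\operatorname{dist}(x,\Omega^c)\ge\rho\}$. For an interior point $x$ of $\Omega$, $V_\Omega^{(\alpha)}(x)=\lim_{\varepsilon\to0^+}\left(\int_{\Omega\setminus B_\varepsilon(x)}|x-\xi|^{\alpha-m}d\xi-\frac{\sigma(S^{m-1})}{-\alpha}\varepsilon^{\alpha}\right)$ if $\alpha<0$, and $V_\Omega^{(0)}(x)=\lim_{\varepsilon\to0^+}\left(\int_{\Omega\setminus B_\varepsilon(x)}|x-\xi|^{-m}d\xi-\sigma(S^{m-1})\log\frac1\varepsilon\right)$ if $\alpha=0$. An $r^{\alpha-m}$-center of $\Omega$ is an interior point of $\Omega$ at which the maximum of $V_\Omega^{(\alpha)}$ over the interior of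 $\Omega$ is attained. The open cone of vertex $x$, axis direction $v\in S^{m-1}$, aperture angle $\kappa$ and height $\delta$ is $\{x+\rho w: 0<\rho<\delta,\ w\in S^{m-1},\ w\cdot v>\cos(\kappa/2)\}$. An open set $U$ satisfies the uniform boundary inner cone condition of aperture angle $\kappa$ and height $\delta$ if for each $x\in\partial U$ there is an open cone of vertex $x$, aperture angle $\kappa$ and height $\delta$ contained in $U$. Minimal unfolded region: for $v\in S^{m-1}$, $b\in\mathbb{R}$, let $\operatorname{Refl}_{v,b}$ be the reflection in the hyperplane $\{z: z\cdot v=b\}$, $\Omega_{v,b}^+=\Omega\cap\{z: z\cdot v\ge b\}$, $l(v)=\min\{a\in\mathbb{R}:\forall b\ge a,\ \operatorname{Refl}_{v,b}(\Omega_{v,b}^+)\subset\Omega\}$, and $Uf(\Omega)=\bigcap_{v\in S^{m-1}}\{z: z\cdot v\le l(v)\}$. Definition of $\tilde R$: let $C_\theta(x;\kappa,\delta)$ be the open cone of vertex $x$, axis direction $\cos\theta\, e_1+\sin\theta\, e_m$, aperture angle $\kappa$ and height $\delta$. For $D>0$, $0<R_0<D$ and $R>0$ put $E(R)=\min_{0\le\theta\le(\pi-\kappa)/2}\left(\int_{C_\theta(Re_1;\kappa,\delta)\cap B_D(0)}|\xi|^{\alpha-m}d\xi-\int_{B_D(0)\setminus B_{R_0}(0)}|\xi|^{\alpha-m}d\xi\right).$ There is a unique positive number $\tilde R=\tilde R(\alpha,\kappa,\delta,D,R_0)$ with $E(\tilde R)=0$; moreover $E(R)>0$ for $R<\tilde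 R$, $E(R)<0$ for $R>\tilde R$, and $\tilde R<R_0$. *)

(* Defs.v *)
From HB Require Import structures.
From mathcomp Require Import all_boot all_order all_algebra.
From mathcomp Require Import all_classical all_reals all_analysis.

Set Implicit Arguments.
Unset Strict Implicit.
Unset Printing Implicit Defensive.

Import Order.TTheory GRing.Theory Num.Theory.
Import numFieldNormedType.Exports.

Local Open Scope classical_set_scope.
Local Open Scope ring_scope.

(* Points of R^m are row vectors 'rV[R]_m. The library's norm on matrices is
   the sup norm; it gives the usual topology and the usual bounded sets, but
   every metric notion below goes through the Euclidean norm [enorm]. *)

(* The sigma-algebra on 'rV[R]_m generated by the coordinate maps, i.e. the
   Borel sigma-algebra of R^m. *)
Section rV_measurable.
Variables (R : realType) (m : nat).

Definition rV_coor (i : 'I_m) (x : 'rV[R]_m) : R := x ord0 i.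

Let rV_set0 : g_sigma_preimage rV_coor set0.
Proof. exact: sigma_algebra0. Qed.

Let rV_setC A : g_sigma_preimage rV_coor A -> g_sigma_preimage rV_coor (~` A).
Proof. exact: sigma_algebraC. Qed.

Let rV_bigcup (F : (set 'rV[R]_m)^nat) :
  (forall i, g_sigma_preimage rV_coor (F i)) ->
  g_sigma_preimage rV_coor (\bigcup_i (F i)).
Proof. exact: sigma_algebra_bigcup. Qed.

HB.instance Definition _ :=
  @isMeasurable.Build default_measure_display 'rV[R]_m
    (g_sigma_preimage rV_coor) rV_set0 rV_setC rV_bigcup.

End rV_measurable.

Section lebesgue_rV.
Variable R : realType.

Definition rV_cons (n : nat) (p : measurableTypeR R * 'rV[R]_n) : 'rV[R]_n.+1 :=
  row_mx (p.1 : R)%:M p.2.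

Lemma rV_cons0 n (p : measurableTypeR R * 'rV[R]_n) : rV_cons p ord0 ord0 = p.1.
Proof.
have -> : ord0 = lshift n ord0 :> 'I_(1 + n) by exact/val_inj.
by rewrite (row_mxEl (p.1%:M : 'rV[R]_1)) mxE eqxx mulr1n.
Qed.

Lemma rV_consS n (p : measurableTypeR R * 'rV[R]_n) (i : 'I_n) :
  rV_cons p ord0 (lift ord0 i) = p.2 ord0 i.
Proof.
have -> : lift ord0 i = rshift 1 i :> 'I_(1 + n) by exact/val_inj.
by rewrite (row_mxEr (p.1%:M : 'rV[R]_1)).
Qed.

Lemma measurable_rV_coor m (i : 'I_m) : measurable_fun setT (@rV_coor R m i).
Proof.
move=> _ Y mY; rewrite setTI; apply: sub_sigma_algebra => /=.
rewrite -bigcup_seq/=; exists i => /=; first by rewrite mem_index_enum.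
by exists Y => //; rewrite setTI.
Qed.

Lemma measurable_fun_rV d (T : measurableType d) m (f : T -> 'rV[R]_m) :
  (forall i, measurable_fun setT (fun t => f t ord0 i)) -> measurable_fun setT f.
Proof.
move=> mf _ A mA; rewrite setTI.
pose S := [set B : set 'rV[R]_m | measurable (f @^-1` B)].
suff : g_sigma_preimage (@rV_coor R m) `<=` S by exact.
apply: smallest_sub.
  split.
  - by rewrite /S/= preimage_set0.
  - by move=> B; rewrite /S/= => mB; rewrite setTD preimage_setC; exact: measurableC.
  - by move=> F mF; rewrite /S/= preimage_bigcup; exact: bigcupT_measurable.
rewrite -bigcup_seq/= => B [i _ [C mC <-]].
rewrite /S/= setTI -comp_preimage -[X in measurable X]setTI.
exact: mf.
Qed.

Lemma measurable_rV_cons n : measurable_fun setT (@rV_cons n).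
Proof.
apply: measurable_fun_rV => i.
have [j ->|->] := unliftP ord0 i.
  under eq_fun do rewrite rV_consS.
  exact: (measurableT_comp (measurable_rV_coor j) measurable_snd).
under eq_fun do rewrite rV_cons0.
exact: (@measurable_fst _ _ (measurableTypeR R) 'rV[R]_n).
Qed.

Definition rV_uncons (n : nat) (x : 'rV[R]_n.+1) : measurableTypeR R * 'rV[R]_n :=
  (x ord0 ord0, \row_i x ord0 (lift ord0 i)).

Lemma rV_consK n : cancel (@rV_cons n) (@rV_uncons n).
Proof.
move=> p; rewrite /rV_uncons rV_cons0 [RHS]surjective_pairing; congr pair.
by apply/rowP => i; rewrite mxE rV_consS.
Qed.

Lemma measurable_rV_uncons n : measurable_fun setT (@rV_uncons n).
Proof.
apply: (@measurable_fun_pair _ _ _ _ (measurableTypeR R) 'rV[R]_n).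
  exact: (@measurable_rV_coor n.+1 ord0).
apply: measurable_fun_rV => i /=; under eq_fun do rewrite mxE.
exact: (@measurable_rV_coor n.+1 (lift ord0 i)).
Qed.

Section rV_push.
Variables (n : nat).
Variable mu : {sigma_finite_measure set 'rV[R]_n -> \bar R}.

Let nu : {measure set (measurableTypeR R * 'rV[R]_n)%type -> \bar R} :=
  (@lebesgue_measure R \x mu)%E.

Let push := pushforward nu (@rV_cons n).

Let mcons (A : set 'rV[R]_n.+1) : measurable A -> measurable (@rV_cons n @^-1` A).
Proof. by move=> mA; rewrite -[X in measurable X]setTI; exact: measurable_rV_cons. Qed.

Let push0 : push set0 = 0%E.
Proof. by rewrite /push /pushforward preimage_set0 measure0. Qed.

Let push_ge0 A : (0 <= push A)%E.
Proof. exact: (measure_ge0 nu). Qed.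

Let push_sigma_additive : semi_sigma_additive push.
Proof.
move=> F mF tF mUF; rewrite /push /pushforward preimage_bigcup.
apply: measure_semi_sigma_additive.
- by move=> k; exact: mcons.
- apply/trivIsetP => /= i j _ _ ij; rewrite -preimage_setI.
  by move/trivIsetP : tF => /(_ _ _ _ _ ij) ->//; rewrite preimage_set0.
- by rewrite -preimage_bigcup; exact: mcons.
Qed.

HB.instance Definition _ := isMeasure.Build _ _ _ push
  push0 push_ge0 push_sigma_additive.

Let nu_sigma_finite : sigma_finite setT nu.
Proof.
have /sigma_finiteP[F [TF ndF Foo]] := sigma_finiteT (@lebesgue_measure R).
have /sigma_finiteP[G [TG ndG Goo]] := sigma_finiteT mu.
exists (fun k => F k `*` G k).
  rewrite -setXTT TF TG predeqE => -[x y]; split.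
    move=> [/= [k _ Fkx] [l _ Gly]]; exists (maxn k l) => //; split.
    - by move: x Fkx; exact/subsetPset/ndF/leq_maxl.
    - by move: y Gly; exact/subsetPset/ndG/leq_maxr.
  by move=> [k _ []/= ? ?]; split; exists k.
move=> k; have [? ?] := Foo k; have [? ?] := Goo k.
split; first exact: measurableX.
rewrite [X in (X < _)%E](_ : _ = (@lebesgue_measure R (F k) * mu (G k))%E).
  by rewrite lte_mul_pinfty// ge0_fin_numE.
exact: (@product_measure1E _ _ (measurableTypeR R)).
Qed.

Let push_sigma_finite : sigma_finite setT push.
Proof.
have [F FT mF] := nu_sigma_finite.
exists (fun k => @rV_uncons n @^-1` F k).
  by rewrite -preimage_bigcup -FT preimage_setT.
move=> k; have [mFk Fk_fin] := mF k; split.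
  by rewrite -[X in measurable X]setTI; exact: measurable_rV_uncons.
rewrite /push /pushforward -comp_preimage.
by rewrite (_ : _ \o _ = id) ?preimage_id//; apply/funext => p; exact: rV_consK.
Qed.

HB.instance Definition _ := Measure_isSigmaFinite.Build _ _ _ push
  push_sigma_finite.

Definition rV_push : {sigma_finite_measure set 'rV[R]_n.+1 -> \bar R} := push.

End rV_push.

(* m-dimensional Lebesgue measure, as the m-fold product of the Lebesgue
   measure of the line: see [lebesgue_rVS] and [lebesgue_rV_rect]. *)
Fixpoint lebesgue_rV (m : nat) :
    {sigma_finite_measure set 'rV[R]_m -> \bar R} :=
  match m with
  | 0 => @dirac _ 'rV[R]_0 0 R
  | n.+1 => rV_push (lebesgue_rV n)
  end.

Lemma lebesgue_rVS n : lebesgue_rV n.+1 =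
  pushforward (@lebesgue_measure R \x lebesgue_rV n)%E (@rV_cons n) :> (_ -> _).
Proof. by []. Qed.

Lemma measurable_rV_rect m (A : 'I_m -> set (measurableTypeR R)) :
  (forall i, measurable (A i)) ->
  measurable [set x : 'rV[R]_m | forall i, A i (x ord0 i)].
Proof.
move=> mA.
rewrite (_ : mkset _ = \bigcap_(i in [set: 'I_m]) (@rV_coor R m i @^-1` A i)).
  apply: fin_bigcap_measurable => // i _.
  rewrite -[X in measurable X]setTI.
  exact: (@measurable_rV_coor m i measurableT _ (mA i)).
by apply/seteqP; split=> x /= Ax i; [move=> _; exact: Ax|exact: (Ax i)].
Qed.

Lemma lebesgue_rV_rect m (A : 'I_m -> set (measurableTypeR R)) :
  (forall i, measurable (A i)) ->
  lebesgue_rV m [set x | forall i, A i (x ord0 i)] =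
  (\prod_(i < m) lebesgue_measure (A i))%E.
Proof.
elim: m A => [|n IH] A mA.
  by rewrite big_ord0 /= diracE mem_set// => -[].
rewrite big_ord_recl -IH; last by move=> i; exact: mA.
rewrite lebesgue_rVS /pushforward.
rewrite -(@product_measure1E _ _ (measurableTypeR R))//; last first.
  exact: (measurable_rV_rect (fun i => mA (lift ord0 i))).
congr (product_measure1 _ _ _).
apply/seteqP; split=> p /=.
  by move=> Ap; split=> [|i]; [rewrite -rV_cons0|rewrite -rV_consS].
move=> [A0 AS] i; have [j ->|->] := unliftP ord0 i.
  by rewrite rV_consS.
by rewrite rV_cons0.
Qed.

End lebesgue_rV.
Arguments lebesgue_rV {R} m.

Section euclidean.
Variables (R : realType) (m : nat).
Implicit Types (x y v w : 'rV[R]_m) (A Omega U : set 'rV[R]_m).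
Implicit Types (rho kappa alpha : R) (delta : \bar R).

Definition dotv x y : R := \sum_(i < m) x ord0 i * y ord0 i.

Definition enorm x : R := Num.sqrt (dotv x x).

(* [eball rho x] is the closed ball of radius [rho] centered at [x]. *)
Definition eball rho x : set 'rV[R]_m := [set y | enorm (y - x) <= rho].

Definition sphere : set 'rV[R]_m := [set v | enorm v = 1].

Definition dist x A : R := inf [set enorm (x - a) | a in A].

Definition diam A : R := sup [set enorm (p.1 - p.2) | p in A `*` A].

Definition solid_cone A : set 'rV[R]_m :=
  [set x | exists t w, [/\ 0 < t, t <= 1, A w & x = t *: w]].

(* The (m-1)-dimensional spherical Lebesgue measure of A `<=` sphere, as m
   times the volume of the cone over A; this is the measure on the sphere for
   which d xi = r^(m-1) dr dsigma in polar coordinates. *)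
Definition sphere_measure A : \bar R :=
  (m%:R%:E * lebesgue_rV m (solid_cone A))%E.

Definition body Omega : Prop :=
  exists U, [/\ open U, bounded_set U & Omega = closure U].

(* Here, in [level] and in [Efun], sup and inf stand for a max and a min. *)
Definition inradius Omega : R := sup [set dist xi (~` Omega) | xi in Omega].

Definition inner_parallel rho Omega : set 'rV[R]_m :=
  [set x | Omega x /\ rho <= dist x (~` Omega)].

(* Meaningful for alpha <= 0 and x in the interior of Omega, where the limit
   exists. The integrals are real-valued ([Rintegral]). *)
Definition potential alpha Omega x : R :=
  let I (eps : R) :=
    \int[lebesgue_rV m]_(xi in Omega `\` eball eps x)
      (enorm (x - xi) `^ (alpha - m%:R)) in
  let S := fine (sphere_measure sphere) in
  if alpha < 0
  then lim ((I eps - S / (- alpha) * eps `^ alpha) @[eps --> 0^'+])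
  else lim ((I eps - S * ln (eps^-1)) @[eps --> 0^'+]).

Definition is_center alpha Omega x : Prop :=
  Omega° x /\
  forall y, Omega° y -> potential alpha Omega y <= potential alpha Omega x.

Definition cone x v kappa delta : set 'rV[R]_m :=
  [set y | exists rho w,
     [/\ 0 < rho, (rho%:E < delta)%E, sphere w,
         cos (kappa / 2) < dotv w v & y = x + rho *: w]].

Definition inner_cone_condition U kappa delta : Prop :=
  forall x, (closure U `\` U°) x ->
    exists2 v, sphere v & cone x v kappa delta `<=` U.

Definition refl v (b : R) x : 'rV[R]_m := x - (2 * (dotv x v - b)) *: v.

Definition cap Omega v (b : R) : set 'rV[R]_m :=
  Omega `&` [set z | b <= dotv z v].

Definition level Omega v : R :=
  inf [set a | forall b, a <= b -> refl v b @` cap Omega v b `<=` Omega].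

Definition Uf Omega : set 'rV[R]_m :=
  [set x | forall v, sphere v -> dotv x v <= level Omega v].

(* The k-th standard unit vector, counted from 0: e_1 is [unit_vec 0] and e_m
   is [unit_vec m.-1]. *)
Definition unit_vec (k : nat) : 'rV[R]_m := \row_j (j == k :> nat)%:R.

End euclidean.

Section Rtilde.
Variables (R : realType) (m : nat).

Definition cone_theta (theta : R) (x : 'rV[R]_m) (kappa : R) (delta : \bar R) :=
  cone x (cos theta *: unit_vec R m 0 + sin theta *: unit_vec R m m.-1)
    kappa delta.

Definition Efun (alpha kappa : R) (delta : \bar R) (D R0 r : R) : R :=
  let f (xi : 'rV[R]_m) := enorm xi `^ (alpha - m%:R) in
  inf [set \int[lebesgue_rV m]_(xi in
              cone_theta theta (r *: unit_vec R m 0) kappa delta `&` eball D 0) f xi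
           - \int[lebesgue_rV m]_(xi in eball D 0 `\` eball R0 0) f xi
      | theta in [set theta | 0 <= theta <= (pi - kappa) / 2]].

(* The positive zero of [Efun], which is unique for 0 < R0 < D. *)
Definition Rtilde (alpha kappa : R) (delta : \bar R) (D R0 : R) : R :=
  get [set r | 0 < r /\ Efun alpha kappa delta D R0 r = 0].

End Rtilde.

(* Main.v *)
From HB Require Import structures.
Require Import Defs.
From mathcomp Require Import all_boot all_order all_algebra.
From mathcomp Require Import all_classical all_reals all_analysis.
From mathcomp Require Import measurable_realfun.
From mathcomp Require Import ring lra.
Import Order.TTheory GRing.Theory Num.Theory.
Import numFieldNormedType.Exports.
Local Open Scope classical_set_scope.
Local Open Scope ring_scope.

Set Implicit Arguments.
Unset Strict Implicit.
Unset Printing Implicit Defensive.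

(** Why the theorem holds. Write V for the potential and k for the primitive of
    S t^(alpha - 1), S being the area of the unit sphere. The counter-term in the
    definition of V is k, up to sign, and the kernel |x - xi|^(alpha - m)
    integrates to k(b) - k(a) over the annulus a < |x - xi| <= b
    ([riesz_annulus]). Hence V(x) is the integral of the kernel over Omega minus
    any ball of center x and radius e contained in Omega, plus k(e)
    ([potentialE]); the limit disappears and potentials can be compared by
    comparing sets.

    Minimal unfolded region ([center_Uf]): if l(v) < x.v, reflect x in a
    hyperplane z.v = b with l(v) < b < x.v. Omega splits into a part which is
    symmetric with respect to this hyperplane, and which contributes equally to
    the potential at x and at its mirror image x', and a rest contained in the
    half space of x', all of whose points are closer to x' than to x. So
    V(x) < V(x') unless the rest is empty. If it is empty for two values of b,
    then Omega is stable under a nontrivial translation, which contradicts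
    boundedness.

    Distance to the complement ([center_inradius]): let r be the distance from
    x to the complement, D the diameter and R0 the inradius. At a boundary point
    nearest to x there is a cone outside Omega, and a rotation brings it to the
    standard position of the definition of E ([nearest_cone]). Comparing Omega
    with the ball of radius D around x gives V(x) < k(D) - J(r), where J(r) is
    the integral over the cone ([potential_lt]). If r is less than a zero t of E,
    a homothety shows J(r) >= J(t) ([riesz_std_cone_mono]), and E(t) = 0 says
    J(t) >= k(D) - k(R0) ([Efun_eq0_le]). Thus V(x) < k(R0). But points whose
    distance to the complement is close to R0 have a potential which is almost
    k(R0) or larger ([center_potential_ge]), so x is not a center.

    Both parts use that Lebesgue measure is invariant under isometries. This
    follows from a Fubini argument: two translation invariant measures are
    proportional ([haar_unique]), and the image of Lebesgue measure under a linear
    isometry gives the same mass to the unit ball ([lebesgue_orth]). *)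

(** * Euclidean geometry of row vectors *)

Section euclid.
Context {R : realType} {m : nat}.
Implicit Types (x y z u v w : 'rV[R]_m) (A : set 'rV[R]_m).

Lemma dotvC x y : dotv x y = dotv y x.
Proof. by apply: eq_bigr => i _; rewrite mulrC. Qed.

Lemma dotvDl x y z : dotv (x + y) z = dotv x z + dotv y z.
Proof. by rewrite -big_split; apply: eq_bigr => i _; rewrite mxE mulrDl. Qed.

Lemma dotvZl a x y : dotv (a *: x) y = a * dotv x y.
Proof. by rewrite mulr_sumr; apply: eq_bigr => i _; rewrite mxE mulrA. Qed.

Lemma dotvNl x y : dotv (- x) y = - dotv x y.
Proof. by rewrite -scaleN1r dotvZl mulN1r. Qed.

Lemma dotvBl x y z : dotv (x - y) z = dotv x z - dotv y z.
Proof. by rewrite dotvDl dotvNl. Qed.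

Lemma dotvDr x y z : dotv z (x + y) = dotv z x + dotv z y.
Proof. by rewrite !(dotvC z) dotvDl. Qed.

Lemma dotvZr a x y : dotv y (a *: x) = a * dotv y x.
Proof. by rewrite !(dotvC y) dotvZl. Qed.

Lemma dotvNr x y : dotv y (- x) = - dotv y x.
Proof. by rewrite !(dotvC y) dotvNl. Qed.

Lemma dotvBr x y z : dotv z (x - y) = dotv z x - dotv z y.
Proof. by rewrite dotvDr dotvNr. Qed.

Lemma dot0v x : dotv 0 x = 0.
Proof. by rewrite -(scale0r 0) dotvZl mul0r. Qed.

Definition dotvE := (dotvDl, dotvDr, dotvNl, dotvNr, dotvZl, dotvZr).

Lemma dotv_ge0 x : 0 <= dotv x x.
Proof. by apply: sumr_ge0 => i _; rewrite -expr2 sqr_ge0. Qed.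

Lemma dotv_eq0 x : dotv x x = 0 -> x = 0.
Proof.
move=> /eqP; rewrite psumr_eq0; last by move=> i _; rewrite -expr2 sqr_ge0.
move=> /allP x0; apply/rowP => i; have := x0 i (mem_index_enum _).
by rewrite mxE -expr2 sqrf_eq0 => /eqP.
Qed.

Lemma enorm_ge0 x : 0 <= enorm x.
Proof. exact: sqrtr_ge0. Qed.

Lemma sqr_enorm x : enorm x ^+ 2 = dotv x x.
Proof. by rewrite sqr_sqrtr// dotv_ge0. Qed.

Lemma enorm0 : enorm (0 : 'rV[R]_m) = 0.
Proof. by rewrite /enorm dot0v sqrtr0. Qed.

Lemma enorm_eq0 x : enorm x = 0 -> x = 0.
Proof. by move=> x0; apply: dotv_eq0; rewrite -sqr_enorm x0 expr0n. Qed.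

Lemma enorm_gt0 x : x != 0 -> 0 < enorm x.
Proof.
move=> x0; rewrite lt_neqAle enorm_ge0 andbT eq_sym.
by apply: contra_neq x0; exact: enorm_eq0.
Qed.

Lemma enormZ a x : enorm (a *: x) = `|a| * enorm x.
Proof. by rewrite /enorm dotvZl dotvZr mulrA -expr2 sqrtrM ?sqr_ge0// sqrtr_sqr. Qed.

Lemma enormN x : enorm (- x) = enorm x.
Proof. by rewrite -scaleN1r enormZ normrN normr1 mul1r. Qed.

Lemma enormB x y : enorm (x - y) = enorm (y - x).
Proof. by rewrite -enormN opprB. Qed.

Lemma cauchy_schwarz x y : dotv x y <= enorm x * enorm y.
Proof.
have [x0|x0] := eqVneq x 0; first by rewrite x0 dot0v enorm0 mul0r.
have [y0|y0] := eqVneq y 0; first by rewrite y0 dotvC dot0v enorm0 mulr0.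
have := dotv_ge0 (enorm y *: x - enorm x *: y).
rewrite !dotvE -!sqr_enorm (dotvC y x).
have := enorm_gt0 x0; have := enorm_gt0 y0.
set a := enorm x; set b := enorm y; set c := dotv x y => b0 a0 H.
have : 0 <= (a * b) * (a * b - c) by nra.
by rewrite pmulr_rge0 ?mulr_gt0// subr_ge0.
Qed.

Lemma enormD x y : enorm (x + y) <= enorm x + enorm y.
Proof.
rewrite -(@ler_pXn2r _ 2)// ?nnegrE ?addr_ge0 ?enorm_ge0//.
rewrite sqr_enorm !dotvE -!sqr_enorm (dotvC y x).
by have := cauchy_schwarz x y; nra.
Qed.

Lemma ler_enormB x y z : enorm (x - z) <= enorm (x - y) + enorm (y - z).
Proof. by rewrite -[leLHS](_ : enorm ((x - y) + (y - z)) = _) ?enormD// subrKA. Qed.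

Lemma abs_coord_le_enorm x i : `|x ord0 i| <= enorm x.
Proof.
rewrite -sqrtr_sqr ler_wsqrtr// /dotv (bigD1 i)//= -expr2 lerDl.
by apply: sumr_ge0 => j _; rewrite -expr2 sqr_ge0.
Qed.

Lemma enorm_le_coord x e : 0 <= e -> (forall i, `|x ord0 i| <= e) ->
  enorm x <= m%:R * e.
Proof.
move=> e0 xe; rewrite -(@ler_pXn2r _ 2)// ?nnegrE ?mulr_ge0 ?enorm_ge0//.
rewrite sqr_enorm; apply: (@le_trans _ _ (\sum_(i < m) e ^+ 2)).
  apply: ler_sum => i _; rewrite -expr2 -real_normK ?num_real//.
  by rewrite ler_pXn2r ?nnegrE// xe.
rewrite sumr_const card_ord -[leLHS]mulr_natl exprMn ler_wpM2r ?sqr_ge0//.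
by rewrite -natrX ler_nat; case: (m) => // n; rewrite -[leqLHS]expn1 leq_pexp2l.
Qed.

(** The topology of row vectors is that of the sup norm, which differs from the
    Euclidean norm by a factor at most m. *)
Lemma nbhs_eballP x A : nbhs x A <-> exists2 e, 0 < e & eball e x `<=` A.
Proof.
split=> [/nbhs_ballP[e/= e0 xA]|[e e0 xA]].
  exists (e / 2); first by rewrite divr_gt0.
  move=> y; rewrite /eball/= => yx; apply: xA; split=> // i j.
  rewrite (ord1 i) -ball_normE/= distrC.
  have := abs_coord_le_enorm (y - x) j; rewrite !mxE => /le_lt_trans; apply.
  by apply: (le_lt_trans yx); lra.
apply/nbhs_ballP; exists (e / m.+1%:R) => /=; first by rewrite divr_gt0.
move=> y [_ xy]; apply: xA; rewrite /eball/=.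
apply: (@le_trans _ _ (m%:R * (e / m.+1%:R))).
  apply: enorm_le_coord => [|i]; first by rewrite divr_ge0// ltW.
  by have := xy ord0 i; rewrite -ball_normE/= distrC !mxE => /ltW.
rewrite mulrCA -[leRHS]mulr1 ler_pM2l// ler_pdivrMr ?ltr0n// mul1r.
by rewrite ler_nat.
Qed.

Lemma enorm_continuous x : continuous (fun y => enorm (y - x)).
Proof.
move=> y; apply/(@cvgrPdist_le _ _ _ _ (nbhs_filter y)) => /= e e0.
apply/nbhs_eballP; exists e => // z; rewrite /eball/= => zy.
rewrite ler_norml; apply/andP; split.
  by have := ler_enormB z y x; lra.
by have := ler_enormB y z x; rewrite (enormB y z); lra.
Qed.

Lemma dotv_continuous v : continuous (fun y => dotv y v).
Proof.
move=> y; apply/(@cvgrPdist_le _ _ _ _ (nbhs_filter y)) => /= e e0; apply/nbhs_eballP.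
have v0 := enorm_ge0 v.
exists (e / (1 + enorm v)); first by rewrite divr_gt0// ltr_wpDr.
move=> z; rewrite /eball/= ler_pdivlMr ?ltr_wpDr// => zy.
have H : forall u, dotv u v <= enorm u * (1 + enorm v).
  by move=> u; apply: (le_trans (cauchy_schwarz _ _)); rewrite ler_wpM2l ?enorm_ge0// lerDr.
rewrite ler_norml; apply/andP; split.
  by have := H (z - y); rewrite dotvBl; lra.
by have := H (y - z); rewrite dotvBl enormB; lra.
Qed.

Lemma eball_closed e x : closed (eball e x).
Proof.
have -> : eball e x = (fun y => enorm (y - x)) @^-1` [set t | t <= e] by [].
by apply: closed_comp; [move=> *; exact: enorm_continuous | exact: closed_le].
Qed.

Lemma bounded_enormP A :
  bounded_set A <-> exists M : R, forall x, A x -> enorm x <= M.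
Proof.
split=> [[M [_ /(_ (M + 1))]]|[M AM]].
  rewrite ltrDl ltr01 => /(_ isT) AM; exists (m%:R * `|M + 1|) => x /AM/= xM.
  apply: enorm_le_coord => // i; apply: le_trans (ler_norm (M + 1)).
  by apply: le_trans xM; rewrite -[`|x|]/(mx_norm x) mx_normrE; apply: (le_bigmax _ (fun i => `|x i.1 i.2|) (ord0, i)).
exists M; split; first exact: num_real.
move=> N MN x Ax; have xN := le_lt_trans (AM _ Ax) MN.
have N0 : 0 <= N by rewrite ltW// (le_lt_trans (enorm_ge0 x)).
rewrite /= -[`|x|]/(mx_norm x) mx_normrE; apply/bigmax_leP; split=> // -[i j] _ /=; rewrite (ord1 i).
by apply: le_trans (ltW xN); exact: abs_coord_le_enorm.
Qed.

Lemma eball_compact e x : compact (eball e x).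
Proof.
apply: bounded_closed_compact; last exact: eball_closed.
apply/bounded_enormP; exists (e + enorm x) => y; rewrite /eball/= => yx.
by have := enormD (y - x) x; rewrite subrK; lra.
Qed.

End euclid.

(** * Borel sets and translation invariance *)

Section borel.
Context {R : realType} {m : nat}.
Implicit Types (A : set 'rV[R]_m).

(** The sigma-algebra is generated by the coordinates, so an open set has to be
    exhausted by countably many boxes: those with a rational center and width
    2 / (k + 1). *)
Lemma open_measurable_rV A : open A -> measurable A.
Proof.
move=> oA.
pose box (p : 'rV[rat]_m * nat) : set 'rV[R]_m :=
  [set y | forall i, `]ratr (p.1 ord0 i) - p.2.+1%:R^-1,
                       ratr (p.1 ord0 i) + p.2.+1%:R^-1[%classic (y ord0 i)].
have -> : A = \bigcup_p (if `[< box p `<=` A >] then box p else set0).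
  apply/seteqP; split=> [x Ax|x [p _]]; last by case: asboolP => // pA /pA.
  have [e e0 xA] := (nbhs_eballP x A).1 (open_nbhs_nbhs (conj oA Ax)).
  have [k ke] : exists k, m%:R * (2 * k.+1%:R^-1) <= e.
    exists (Num.trunc (m%:R * 2 / e)); rewrite mulrA ler_pdivrMr ?ltr0n//.
    by rewrite [leRHS]mulrC -ler_pdivrMr// ltW// truncnS_gt.
  have k0 : 0 < k.+1%:R^-1 :> R by rewrite invr_gt0 ltr0n.
  have /choice[q qx] : forall i, exists q : rat,
      ratr q \in `]x ord0 i - k.+1%:R^-1, x ord0 i + k.+1%:R^-1[.
    move=> i; suff /rat_in_itvoo[q qx] :
      x ord0 i - k.+1%:R^-1 < x ord0 i + k.+1%:R^-1 by exists q.
    by rewrite ltrBlDr -addrA ltrDl addr_gt0.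
  exists (\row_i q i, k) => //; case: asboolP => [_|[]].
    move=> i /=; rewrite mxE in_itv/=.
    have := qx i; rewrite in_itv/=; move: (ratr (q i)) (k.+1%:R^-1) => r s /andP[? ?].
    by apply/andP; split; lra.
  move=> y yq; apply: xA; apply: le_trans ke; apply: enorm_le_coord => [|i].
    by rewrite mulr_ge0// ltW.
  have := yq i; have := qx i; rewrite /= !mxE !in_itv/=.
  move: (ratr (q i)) (k.+1%:R^-1) => r s /andP[? ?] /andP[? ?].
  by rewrite ler_norml; apply/andP; split; lra.
apply: countable_bigcupT_measurable => // p.
case: ifP => // _.
apply: (@measurable_rV_rect R m (fun i => `]ratr (p.1 ord0 i) - p.2.+1%:R^-1,
  ratr (p.1 ord0 i) + p.2.+1%:R^-1[%classic)) => i.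
exact: measurable_itv.
Qed.

Lemma closed_measurable_rV A : closed A -> measurable A.
Proof.
move=> cA; rewrite -[A]setCK; apply: measurableC; apply: open_measurable_rV.
by rewrite openC.
Qed.

Lemma continuous_measurable_rV (f : 'rV[R]_m -> R) :
  continuous f -> measurable_fun setT f.
Proof.
move=> cf; apply: (measurability (@RGenOpens.G R)).
  exact: RGenOpens.measurableE.
move=> _ [_ [a [b ->]] <-]; rewrite setTI; apply: open_measurable_rV.
by apply: open_comp; [move=> x _; exact: cf | exact: interval_open].
Qed.

Lemma measurable_enormB a : measurable_fun setT (fun x : 'rV[R]_m => enorm (x - a)).
Proof. by apply: continuous_measurable_rV; exact: enorm_continuous. Qed.

Lemma measurable_dotv v : measurable_fun setT (fun x : 'rV[R]_m => dotv x v).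
Proof. by apply: continuous_measurable_rV; exact: dotv_continuous. Qed.

Lemma measurable_eball e (x : 'rV[R]_m) : measurable (eball e x).
Proof. by apply: closed_measurable_rV; exact: eball_closed. Qed.

Lemma measurable_rV_add d (T : measurableType d) (f g : T -> 'rV[R]_m) :
  measurable_fun setT f -> measurable_fun setT g ->
  measurable_fun setT (fun t => f t + g t).
Proof.
move=> mf mg; apply: measurable_fun_rV => i; under eq_fun do rewrite mxE.
by apply: measurable_funD;
  [exact: (measurableT_comp (measurable_rV_coor i) mf)
  |exact: (measurableT_comp (measurable_rV_coor i) mg)].
Qed.

Lemma measurable_rV_scale d (T : measurableType d) (h : T -> R) (f : T -> 'rV[R]_m) :
  measurable_fun setT h -> measurable_fun setT f ->
  measurable_fun setT (fun t => h t *: f t).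
Proof.
move=> mh mf; apply: measurable_fun_rV => i; under eq_fun do rewrite mxE.
by apply: measurable_funM => //; exact: (measurableT_comp (measurable_rV_coor i) mf).
Qed.

Lemma measurable_preimage d (T : measurableType d) d' (U : measurableType d')
  (f : T -> U) (A : set U) :
  measurable_fun setT f -> measurable A -> measurable (f @^-1` A).
Proof. by move=> mf mA; rewrite -[X in measurable X]setTI; exact: mf. Qed.

End borel.

(** Taking the measurability of f as an argument makes the image measure
    available as a bundled measure. *)
Definition image_measure {d d' : measure_display} {T : measurableType d}
    {U : measurableType d'} {R : realType} (mu : {measure set T -> \bar R})
    (f : T -> U) (mf : measurable_fun setT f) : {measure set U -> \bar R} :=
  measure_function_pushforward__canonical__measure_function_Measure mu mf.

Definition translation_invariant {R : realType} {m : nat}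
    (mu : set 'rV[R]_m -> \bar R) :=
  forall (t : 'rV[R]_m) (A : set 'rV[R]_m), measurable A -> mu ((fun x => x + t) @^-1` A) = mu A.

Section translation.
Context {R : realType}.

Lemma measurable_addr {m} (t : 'rV[R]_m) : measurable_fun setT (fun x : 'rV[R]_m => x + t).
Proof. by apply: measurable_rV_add; [exact: measurable_id|exact: measurable_cst]. Qed.

Lemma lebesgue_measureD (t : R) (A : set (measurableTypeR R)) : measurable A ->
  lebesgue_measure ((fun x : R => x + t) @^-1` A) = lebesgue_measure A.
Proof.
move=> mA; have mt : measurable_fun setT (fun x : measurableTypeR R => (x + t : measurableTypeR R)).
  by apply: measurable_funD; [exact: measurable_id|exact: measurable_cst].
have := @lebesgue_measure_unique R _ _ A mA.
move=> /(_ (image_measure lebesgue_measure mt)) H.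
rewrite [RHS]H// => _ [[a b] _ <-].
rewrite /= /pushforward/=.
have -> : (fun x : R => x + t) @^-1` `]a, b] = `]a - t, b - t]%classic.
  by apply/seteqP; split=> x /=; rewrite !in_itv/= ltrBlDr lerBrDr.
rewrite !lebesgue_measure_itv/= !lte_fin ltrD2r.
by case: ifPn => // _; rewrite -!EFinB; congr EFin; lra.
Qed.

(** By induction on the dimension: the translated product measure agrees with
    the product measure on rectangles. *)
Lemma lebesgue_rV_translation m : translation_invariant (@lebesgue_rV R m).
Proof.
elim: m => [|n IH] t A mA.
  by congr (lebesgue_rV 0 _); apply/seteqP; split=> x /=;
    rewrite (_ : x + t = x)//; apply/rowP => -[].
rewrite lebesgue_rVS /pushforward.
pose t' : 'rV[R]_n := \row_i t ord0 (lift ord0 i).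
pose tau (p : measurableTypeR R * 'rV[R]_n) : measurableTypeR R * 'rV[R]_n :=
  (p.1 + t ord0 ord0, p.2 + t').
have consD p : rV_cons p + t = rV_cons (tau p).
  apply/rowP => i; rewrite mxE; have [j ->|->] := unliftP ord0 i.
    by rewrite !rV_consS !mxE.
  by rewrite !rV_cons0.
have mtau : measurable_fun setT tau.
  apply: (@measurable_fun_pair _ _ _ _ (measurableTypeR R) 'rV[R]_n).
    apply: measurable_funD; [exact: (@measurable_fst _ _ (measurableTypeR R))|exact: measurable_cst].
  by apply: measurable_rV_add; [exact: (@measurable_snd _ _ (measurableTypeR R))|exact: measurable_cst].
have -> : rV_cons (n:=n) @^-1` ((fun x => x + t) @^-1` A) =
          tau @^-1` (rV_cons (n:=n) @^-1` A).
  by apply/seteqP; split=> p /=; rewrite consD.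
have mB := measurable_preimage (@measurable_rV_cons R n) mA.
have := @product_measure_unique _ _ _ _ R lebesgue_measure (lebesgue_rV n)
  (image_measure (lebesgue_measure \x lebesgue_rV n)%E mtau) _ _ mB.
move=> -> // A1 A2 mA1 mA2; rewrite /= /pushforward.
rewrite (_ : tau @^-1` _ = ((fun x : R => x + t ord0 ord0) @^-1` A1) `*`
  ((fun x => x + t') @^-1` A2))//.
have mA1' := @measurable_preimage _ _ _ _ (fun x : measurableTypeR R => (x + t ord0 ord0 : measurableTypeR R)) A1 ^~ mA1.
rewrite product_measure1E.
- by rewrite -(lebesgue_measureD (t ord0 ord0) mA1) -(IH t' A2 mA2).
- by apply: mA1'; apply: measurable_funD; [exact: measurable_id|exact: measurable_cst].
- by apply: measurable_preimage mA2; exact: measurable_addr.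
Qed.

End translation.

(** * Uniqueness of translation invariant measures *)

Section haar.
Context {R : realType} {m : nat}.
Implicit Types (A B : set 'rV[R]_m).

Lemma integral_section (mu nu : {sigma_finite_measure set 'rV[R]_m -> \bar R})
    (E : set ('rV[R]_m * 'rV[R]_m)) : measurable E ->
  (\int[mu]_x nu (xsection E x) = \int[nu]_y mu (ysection E y))%E.
Proof.
move=> mE; have := indic_fubini_tonelli mu nu mE.
by rewrite (indic_fubini_tonelli_FE nu mE) (indic_fubini_tonelli_GE mu mE).
Qed.

Lemma integral_cst_on (mu : {measure set 'rV[R]_m -> \bar R}) A (c : \bar R) :
  measurable A -> (0 <= c)%E ->
  (\int[mu]_x (if x \in A then c else 0) = c * mu A)%E.
Proof.
move=> mA c0; rewrite -integral_cst// [RHS]integral_mkcond; apply: eq_integral => x _.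
by rewrite patchE.
Qed.

(** Integrate the indicator of the set of (x, y) with x in A and x + y in B.
    With x fixed, translating by x gives nu(B) mu(A); with y fixed, the
    substitution of x - y for x turns the conditions into x - y in A and x in B,
    and integrating y first gives nu(- A) mu(B). *)
Lemma translation_invariant_mul (mu nu : {sigma_finite_measure set 'rV[R]_m -> \bar R}) A B :
  translation_invariant mu -> translation_invariant nu ->
  measurable A -> measurable B ->
  (nu B * mu A = nu (-%R @^-1` A) * mu B)%E.
Proof.
move=> tmu tnu mA mB.
have madd : measurable_fun setT (fun p : 'rV[R]_m * 'rV[R]_m => p.1 + p.2).
  by apply: measurable_rV_add; [exact: measurable_fst|exact: measurable_snd].
have mopp d (T : measurableType d) (f : T -> 'rV[R]_m) :
    measurable_fun setT f -> measurable_fun setT (fun t => - f t).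
  move=> mf; under eq_fun do rewrite -scaleN1r.
  by apply: measurable_rV_scale => //; exact: measurable_cst.
have msub : measurable_fun setT (fun p : 'rV[R]_m * 'rV[R]_m => p.1 - p.2).
  by apply: measurable_rV_add; [exact: measurable_fst|apply: mopp; exact: measurable_snd].
pose E := [set p : 'rV[R]_m * 'rV[R]_m | A p.1 /\ B (p.1 + p.2)].
have mE : measurable E.
  apply: measurableI; first exact: measurable_preimage (measurable_fst) mA.
  exact: measurable_preimage madd mB.
pose F := [set p : 'rV[R]_m * 'rV[R]_m | B p.1 /\ A (p.1 - p.2)].
have mF : measurable F.
  apply: measurableI; first exact: measurable_preimage (measurable_fst) mB.
  exact: measurable_preimage msub mA.
rewrite -integral_cst_on// -integral_cst_on//.
transitivity (\int[mu]_x nu (xsection E x))%E.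
  apply: eq_integral => x _; case: ifPn => xA.
    rewrite -[LHS](tnu x)//; congr (nu _); apply/seteqP; split=> y; rewrite /xsection/= inE /E/= addrC.
      by move=> ?; split=> //; exact: set_mem.
    by case.
  rewrite -[LHS](measure0 nu); congr (nu _); apply/seteqP; split=> // y.
  by rewrite /xsection/= inE => -[/mem_set]; rewrite (negbTE xA).
rewrite integral_section//.
transitivity (\int[nu]_y mu (ysection F y))%E.
  apply: eq_integral => y _; rewrite -[RHS](tmu y); last exact: measurable_ysection.
  congr (mu _); apply/seteqP; split=> x; by rewrite /ysection/= !inE /E /F/= addrK => -[].
rewrite -integral_section//; apply: eq_integral => x _; case: ifPn => xB.
  rewrite -[RHS](tnu (- x)); last by apply: measurable_preimage mA; apply: mopp; exact: measurable_id.
  congr (nu _); apply/seteqP; split=> y; rewrite /xsection/= inE /F/= opprB.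
    by case.
  by move=> ?; split=> //; exact: set_mem.
rewrite -[RHS](measure0 nu); congr (nu _); apply/seteqP; split=> // y.
by rewrite /xsection/= inE => -[/mem_set]; rewrite (negbTE xB).
Qed.

Definition cube : set 'rV[R]_m := [set x | forall i, `[0, 1]%classic (x ord0 i)].

Lemma measurable_cube : measurable cube.
Proof. by apply: (@measurable_rV_rect R m (fun=> `[0, 1]%classic)) => i; exact: measurable_itv. Qed.

Lemma lebesgue_cube : lebesgue_rV m cube = 1%E.
Proof.
rewrite (@lebesgue_rV_rect R m (fun=> `[0, 1]%classic)); last by move=> i; exact: measurable_itv.
by rewrite big1// => i _; rewrite lebesgue_measure_itv/= lte_fin ltr01 oppr0 adde0.
Qed.

(** [translation_invariant_mul] for mu and for Lebesgue measure itself, with B the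
    unit cube: the second instance replaces - A by A. *)
Lemma haar_unique (mu : {sigma_finite_measure set 'rV[R]_m -> \bar R}) A :
  translation_invariant mu -> measurable A ->
  mu A = (mu cube * lebesgue_rV m A)%E.
Proof.
move=> tmu mA; have tl := @lebesgue_rV_translation R m.
have H nu := fun tnu => @translation_invariant_mul nu (lebesgue_rV m) A cube tnu tl mA measurable_cube.
have := H _ tmu; have := H _ tl.
by rewrite lebesgue_cube !mul1e mule1 => <- ->; rewrite muleC.
Qed.

Section pushforward.
Variables (mu : {sigma_finite_measure set 'rV[R]_m -> \bar R}).
Variables (T S : 'rV[R]_m -> 'rV[R]_m).
Hypotheses (mT : measurable_fun setT T) (mS : measurable_fun setT S).
Hypothesis TK : cancel T S.

Let push := pushforward mu T.

HB.instance Definition _ := Measure.copy push (image_measure mu mT).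

Let push_sigma_finite : sigma_finite setT push.
Proof.
have [F FT mF] := sigma_finiteT mu.
exists (fun k => S @^-1` F k).
  by rewrite -preimage_bigcup -FT preimage_setT.
move=> k; have [mFk Fk_fin] := mF k; split; first exact: measurable_preimage mS mFk.
by rewrite /push/= /pushforward -comp_preimage (_ : S \o T = id)//; apply/funext.
Qed.

HB.instance Definition _ := Measure_isSigmaFinite.Build _ _ _ push
  push_sigma_finite.

(** The inverse map transports an exhaustion by sets of finite measure. *)
Definition pushforward_inv : {sigma_finite_measure set 'rV[R]_m -> \bar R} := push.

Lemma pushforward_invE A : pushforward_inv A = mu (T @^-1` A).
Proof. by []. Qed.

End pushforward.
End haar.

(** * Volume of balls, linear isometries and homotheties *)

Section volume.
Context {R : realType} {m : nat}.
Implicit Types (A B : set 'rV[R]_m) (x y u v : 'rV[R]_m).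

Lemma lebesgue_rV_box (a b : 'rV[R]_m) : (forall i, a ord0 i <= b ord0 i) ->
  lebesgue_rV m [set y | forall i, `[a ord0 i, b ord0 i]%classic (y ord0 i)] =
  (\prod_(i < m) (b ord0 i - a ord0 i))%:E.
Proof.
move=> ab; rewrite (@lebesgue_rV_rect R m (fun i => `[a ord0 i, b ord0 i]%classic)); last by move=> i; exact: measurable_itv.
rewrite -prodEFin; apply: eq_bigr => i _; rewrite lebesgue_measure_itv/= lte_fin.
rewrite EFinB; case: ltP => // ba; rewrite -EFinB (_ : _ - _ = 0)//.
by apply/eqP; rewrite subr_eq0 eq_le ba ab.
Qed.

Lemma lebesgue_eball_fin e x : (lebesgue_rV m (eball e x) < +oo)%E.
Proof.
have [e0|e0] := ltP e 0.
  rewrite (_ : eball e x = set0) ?measure0//; apply/seteqP; split=> // y.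
  by rewrite /eball/= => /le_lt_trans/(_ e0); rewrite ltNge enorm_ge0.
pose a : 'rV[R]_m := \row_i (x ord0 i - e); pose b : 'rV[R]_m := \row_i (x ord0 i + e).
have ab i : a ord0 i <= b ord0 i by rewrite !mxE; lra.
apply: (@le_lt_trans _ _ (lebesgue_rV m
  [set y | forall i, `[a ord0 i, b ord0 i]%classic (y ord0 i)])).
  apply: le_measure; rewrite ?inE; [exact: measurable_eball| |].
    apply: (@measurable_rV_rect R m (fun i => `[a ord0 i, b ord0 i]%classic)) => i.
    exact: measurable_itv.
  move=> y /= yx i; rewrite in_itv/= !mxE.
  have := le_trans (abs_coord_le_enorm (y - x) i) yx; rewrite !mxE ler_norml.
  by move=> /andP[? ?]; apply/andP; split; lra.
by rewrite lebesgue_rV_box// ltry.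
Qed.

Lemma lebesgue_eball_gt0 e x : 0 < e -> (0 < lebesgue_rV m (eball e x))%E.
Proof.
move=> e0; pose d := e / m.+1%:R; have d0 : 0 < d by rewrite divr_gt0// ltr0n.
pose a : 'rV[R]_m := \row_i (x ord0 i - d); pose b : 'rV[R]_m := \row_i (x ord0 i + d).
have ab i : a ord0 i <= b ord0 i by rewrite !mxE; lra.
apply: (@lt_le_trans _ _ (lebesgue_rV m
  [set y | forall i, `[a ord0 i, b ord0 i]%classic (y ord0 i)])).
  rewrite lebesgue_rV_box// lte_fin prodr_gt0// => i _; rewrite !mxE; lra.
apply: le_measure; rewrite ?inE; [|exact: measurable_eball|].
  apply: (@measurable_rV_rect R m (fun i => `[a ord0 i, b ord0 i]%classic)) => i.
  exact: measurable_itv.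
move=> y /= yab; apply: (@le_trans _ _ (m%:R * d)); last first.
  by rewrite /d mulrCA -[leRHS]mulr1 ler_pM2l// ler_pdivrMr ?ltr0n// mul1r ler_nat.
apply: enorm_le_coord => [|i]; first exact: ltW.
by have := yab i; rewrite in_itv/= !mxE ler_norml => /andP[? ?]; apply/andP; split; lra.
Qed.

Lemma lebesgue_nbhs_gt0 A x : measurable A -> nbhs x A -> (0 < lebesgue_rV m A)%E.
Proof.
move=> mA /nbhs_eballP[e e0 eA]; apply: lt_le_trans (lebesgue_eball_gt0 x e0) _.
by apply: le_measure; rewrite ?inE//; exact: measurable_eball.
Qed.

(** Invertibility is a field, which avoids a dimension count. *)
Record orthogonal (T : 'rV[R]_m -> 'rV[R]_m) : Prop := Orthogonal {
  orthD : forall x y, T (x + y) = T x + T y;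
  orthZ : forall a x, T (a *: x) = a *: T x;
  orth_dotv : forall x y, dotv (T x) (T y) = dotv x y;
  orth_inv : exists2 S, cancel T S & cancel S T
}.

Lemma dotv_delta x i : dotv x (delta_mx ord0 i) = x ord0 i.
Proof.
rewrite /dotv (bigD1 i)//= mxE !eqxx mulr1 big1 ?addr0// => j ji.
by rewrite mxE (negbTE ji) andbF mulr0.
Qed.

Lemma orth_enorm T x : orthogonal T -> enorm (T x) = enorm x.
Proof. by move=> oT; rewrite /enorm (orth_dotv oT). Qed.

Lemma orthN T x : orthogonal T -> T (- x) = - T x.
Proof. by move=> oT; rewrite -scaleN1r (orthZ oT) scaleN1r. Qed.

Lemma orthB T x y : orthogonal T -> T (x - y) = T x - T y.
Proof. by move=> oT; rewrite (orthD oT) (orthN _ oT). Qed.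

Lemma orth0 T : orthogonal T -> T 0 = 0.
Proof. by move=> oT; have := orthZ oT 0 0; rewrite !scale0r. Qed.

Lemma orth_comp T U : orthogonal T -> orthogonal U -> orthogonal (T \o U).
Proof.
move=> oT oU; have [S TS ST] := orth_inv oT; have [V UV VU] := orth_inv oU.
split=> [x y|a x|x y|] /=.
- by rewrite (orthD oU) (orthD oT).
- by rewrite (orthZ oU) (orthZ oT).
- by rewrite (orth_dotv oT) (orth_dotv oU).
by exists (V \o S) => x /=; rewrite ?TS ?UV ?VU ?ST.
Qed.

Lemma orth_id : orthogonal id.
Proof. by split=> //; exists id. Qed.

Lemma orth_inverse T S : orthogonal T -> cancel T S -> cancel S T -> orthogonal S.
Proof.
move=> oT TS ST; split=> [x y|a x|x y|]; last by exists T.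
- by apply: (can_inj TS); rewrite (orthD oT) !ST.
- by apply: (can_inj TS); rewrite (orthZ oT) !ST.
- by rewrite -(orth_dotv oT) !ST.
Qed.

Lemma measurable_orth T : orthogonal T -> measurable_fun setT T.
Proof.
move=> oT; have [S TS ST] := orth_inv oT; apply: measurable_fun_rV => i.
under eq_fun do rewrite -dotv_delta -[delta_mx _ _]ST (orth_dotv oT).
exact: measurable_dotv.
Qed.

(** The image of Lebesgue measure is translation invariant, hence a multiple of
    Lebesgue measure; the unit ball shows that the factor is 1. *)
Lemma lebesgue_orth T A : orthogonal T -> measurable A ->
  lebesgue_rV m (T @^-1` A) = lebesgue_rV m A.
Proof.
move=> oT mA; have [S TS ST] := orth_inv oT.
have oS := orth_inverse oT TS ST.
pose mu := pushforward_inv (lebesgue_rV m) (measurable_orth oT) (measurable_orth oS) TS.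
have tmu : translation_invariant mu.
  move=> t B mB; rewrite !pushforward_invE -[RHS](lebesgue_rV_translation (S t)).
    by congr (lebesgue_rV m _); apply/seteqP; split=> x /=; rewrite (orthD oT) ST.
  by apply: measurable_preimage mB; exact: measurable_orth.
suff mu1 : mu cube = 1%E by rewrite -[LHS]/(mu A) haar_unique// mu1 mul1e.
have := haar_unique tmu (measurable_eball 1 0); rewrite pushforward_invE.
rewrite [X in lebesgue_rV m X = _](_ : _ = eball 1 0); last first.
  by rewrite /eball; apply/seteqP; split=> x /=; rewrite !subr0 orth_enorm.
have := lebesgue_eball_fin 1 (0 : 'rV[R]_m); have := lebesgue_eball_gt0 (0 : 'rV[R]_m) ltr01.
case: (lebesgue_rV m (eball 1 0)) => [c| |]; [|by rewrite ltxx|by []].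
rewrite lte_fin => c0 _.
case: (mu cube) => [d| |].
  by rewrite -EFinM => -[/eqP]; rewrite -subr_eq0 -{1}(mul1r c) -mulrBl mulf_eq0 (gt_eqF c0) orbF subr_eq0 => /eqP <-.
  by rewrite gt0_mulye// lte_fin.
by rewrite gt0_mulNye// lte_fin.
Qed.

Lemma measurable_scale (l : R) : measurable_fun setT (fun x : 'rV[R]_m => l *: x).
Proof. by apply: measurable_rV_scale; [exact: measurable_cst|exact: measurable_id]. Qed.

(** Here the unit cube computes the factor between the two translation invariant
    measures. *)
Lemma lebesgue_scale l A : 0 < l -> measurable A ->
  lebesgue_rV m ((fun x => l *: x) @^-1` A) = ((l ^- m)%:E * lebesgue_rV m A)%E.
Proof.
move=> l0 mA.
have lK : cancel (fun x => l *: x) (fun x : 'rV[R]_m => l^-1 *: x).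
  by move=> x; rewrite scalerA mulVf ?scale1r// gt_eqF.
pose mu := pushforward_inv (lebesgue_rV m) (measurable_scale l) (measurable_scale l^-1) lK.
have tmu : translation_invariant mu.
  move=> t B mB; rewrite !pushforward_invE -[RHS](lebesgue_rV_translation (l^-1 *: t)).
    congr (lebesgue_rV m _); apply/seteqP; split=> x /=;
    by rewrite scalerDr scalerA mulfV ?scale1r// gt_eqF.
  by apply: measurable_preimage mB; exact: measurable_scale.
have := haar_unique tmu mA; rewrite pushforward_invE => ->; congr *%E.
rewrite pushforward_invE.
transitivity (lebesgue_rV m [set y | forall i, `[(0 : 'rV[R]_m) ord0 i,
    (const_mx l^-1 : 'rV[R]_m) ord0 i]%classic (y ord0 i)]); last first.
  rewrite lebesgue_rV_box; last by move=> i; rewrite !mxE invr_ge0 ltW.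
  by under eq_bigr do rewrite !mxE subr0; rewrite prodr_const card_ord exprVn.
congr (lebesgue_rV m _); apply/seteqP; split=> x + i => /(_ i); rewrite /= !in_itv/= !mxE => /andP[x0 x1].
  by rewrite -(pmulr_rge0 _ l0) x0/= -[l^-1]mul1r ler_pdivlMr// mulrC.
by rewrite (pmulr_rge0 _ l0) x0/= mulrC -ler_pdivlMr// mul1r.
Qed.

End volume.

(** * Integrals of the Riesz kernel *)

Lemma ge0_integral_image {d d' : measure_display} {T : measurableType d}
    {U : measurableType d'} {R : realType} (mu : {measure set T -> \bar R})
    (f : T -> U) (mf : measurable_fun setT f) (D : set U) (g : U -> \bar R) :
  measurable D -> measurable_fun D g -> (forall y, (0 <= g y)%E) ->
  (\int[image_measure mu mf]_(y in D) g y = \int[mu]_(x in f @^-1` D) g (f x))%E.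
Proof.
by move=> mD mg g0; apply: (ge0_integral_pushforward mf mu mD mg) => y _; exact: g0.
Qed.

Section riesz.
Context {R : realType} {m : nat}.
Variable alpha : R.
Hypothesis alpham : alpha <= m%:R.
Implicit Types (A B : set 'rV[R]_m) (x y : 'rV[R]_m).

(** Extended valued, so that additivity and monotonicity in A hold with no
    condition of integrability near x. *)
Definition riesz x A : \bar R :=
  (\int[lebesgue_rV m]_(xi in A) (enorm (x - xi) `^ (alpha - m%:R))%:E)%E.

Lemma measurable_riesz x A :
  measurable_fun A (fun xi => (enorm (x - xi) `^ (alpha - m%:R))%:E).
Proof.
apply: measurable_funTS; apply/measurable_EFinP.
apply: (measurableT_comp (measurable_powR (alpha - m%:R))).
by under eq_fun do rewrite enormB; exact: measurable_enormB.
Qed.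

Lemma riesz_ge0 x A : (0 <= riesz x A)%E.
Proof. by apply: integral_ge0 => xi _; rewrite lee_fin powR_ge0. Qed.

Lemma riesz_setU x A B : measurable A -> measurable B -> A `&` B = set0 ->
  riesz x (A `|` B) = (riesz x A + riesz x B)%E.
Proof.
move=> mA mB AB; apply: ge0_integral_setU => //; first exact: measurable_riesz.
  by move=> xi _; rewrite lee_fin powR_ge0.
by rewrite disj_set2E; apply/eqP.
Qed.

Lemma le_riesz x A B : measurable A -> measurable B -> A `<=` B ->
  (riesz x A <= riesz x B)%E.
Proof.
move=> mA mB AB; apply: ge0_subset_integral => //; first exact: measurable_riesz.
by move=> xi _; rewrite lee_fin powR_ge0.
Qed.

Lemma powR_anti p (s t : R) : p <= 0 -> 0 < s -> s <= t -> t `^ p <= s `^ p.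
Proof.
move=> p0 s0 st; have t0 := lt_le_trans s0 st.
rewrite -[p]opprK !(powRN _ (- p)) lef_pV2 ?posrE ?powR_gt0//.
by apply: ge0_ler_powR => //; rewrite ?nnegrE ?oppr_ge0// ltW.
Qed.

Let p0 : alpha - m%:R <= 0. Proof. by rewrite subr_le0. Qed.

Lemma riesz_le x A e : 0 < e -> measurable A ->
  (forall xi, A xi -> e <= enorm (x - xi)) ->
  (riesz x A <= (e `^ (alpha - m%:R))%:E * lebesgue_rV m A)%E.
Proof.
move=> e0 mA Ae; rewrite -integral_cst//; apply: ge0_le_integral => //.
- by move=> xi _; rewrite lee_fin powR_ge0.
- exact: measurable_riesz.
- by move=> xi /Ae xe; rewrite lee_fin powR_anti.
Qed.

Lemma riesz_ge x A e : measurable A ->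
  (forall xi, A xi -> 0 < enorm (x - xi) <= e) ->
  ((e `^ (alpha - m%:R))%:E * lebesgue_rV m A <= riesz x A)%E.
Proof.
move=> mA Ae; rewrite -integral_cst//; apply: ge0_le_integral => //.
- by move=> xi _; rewrite lee_fin powR_ge0.
- exact: measurable_riesz.
- by move=> xi /Ae/andP[? ?]; rewrite lee_fin powR_anti.
Qed.

Lemma riesz_fin x A e M : 0 < e -> measurable A ->
  (forall xi, A xi -> e <= enorm (x - xi) <= M) -> riesz x A \is a fin_num.
Proof.
move=> e0 mA Ae; rewrite ge0_fin_numE ?riesz_ge0//.
apply: (le_lt_trans (@riesz_le _ _ e _ _ _)) => //; first by move=> xi /Ae/andP[].
apply: (@le_lt_trans _ _ ((e `^ (alpha - m%:R))%:E * lebesgue_rV m (eball M x))%E).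
  apply: lee_wpmul2l; first by rewrite lee_fin powR_ge0.
  apply: le_measure; rewrite ?inE//; first exact: measurable_eball.
  by move=> xi /Ae; rewrite /eball/= enormB => /andP[].
by rewrite lte_mul_pinfty ?lee_fin ?powR_ge0// lebesgue_eball_fin.
Qed.

Lemma riesz_gt0 x A e M (z : 'rV[R]_m) : 0 < e -> measurable A ->
  (forall xi, A xi -> e <= enorm (x - xi) <= M) -> nbhs z A ->
  (0 < riesz x A)%E.
Proof.
move=> e0 mA Ae zA.
have Az := nbhs_singleton zA.
have M0 : 0 < M by have := Ae _ Az; case/andP => ? ?; lra.
apply: lt_le_trans (@riesz_ge x A M mA _).
  by rewrite mule_gt0 ?lte_fin ?powR_gt0//; exact: lebesgue_nbhs_gt0 zA.
by move=> xi /Ae/andP[? ->]; rewrite andbT; lra.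
Qed.

Lemma riesz_preimage (T : 'rV[R]_m -> 'rV[R]_m) x A : measurable A ->
  measurable_fun setT T ->
  (forall B, measurable B -> lebesgue_rV m (T @^-1` B) = lebesgue_rV m B) ->
  (forall y z, enorm (T y - T z) = enorm (y - z)) ->
  riesz x (T @^-1` A) = riesz (T x) A.
Proof.
move=> mA mT invT isoT; rewrite /riesz.
rewrite [RHS](eq_measure_integral (image_measure (lebesgue_rV m) mT)); last first.
  by move=> B mB _; rewrite /= /pushforward invT.
rewrite (ge0_integral_image (lebesgue_rV m) mT mA (@measurable_riesz (T x) A)); last first.
  by move=> xi; rewrite lee_fin powR_ge0.
by apply: eq_integral => xi _ /=; rewrite isoT.
Qed.

Lemma riesz_translate t x A : measurable A ->
  riesz x ((fun y => y + t) @^-1` A) = riesz (x + t) A.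
Proof.
move=> mA; apply: riesz_preimage => //; first exact: measurable_addr.
  by move=> B mB; exact: lebesgue_rV_translation.
by move=> y z; rewrite opprD addrACA subrr addr0.
Qed.

Lemma riesz_orth T x A : orthogonal T -> measurable A ->
  riesz x (T @^-1` A) = riesz (T x) A.
Proof.
move=> oT mA; apply: riesz_preimage => //; first exact: measurable_orth.
  by move=> B mB; exact: lebesgue_orth.
by move=> y z; rewrite -(orthB y z oT) (orth_enorm _ oT).
Qed.

(** The kernel is homogeneous of degree alpha - m and the volume of degree m. *)
Lemma riesz_scale l A : 0 < l -> measurable A ->
  riesz 0 ((fun y => l *: y) @^-1` A) = ((l `^ (- alpha))%:E * riesz 0 A)%E.
Proof.
move=> l0 mA; rewrite /riesz.
have lm0 : 0 <= l ^- m by rewrite invr_ge0 exprn_ge0// ltW.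
have H : (\int[lebesgue_rV m]_(xi in (fun y => l *: y) @^-1` A)
    (enorm (0 - l *: xi) `^ (alpha - m%:R))%:E =
    (l ^- m)%:E * \int[lebesgue_rV m]_(xi in A) (enorm (0 - xi) `^ (alpha - m%:R))%:E)%E.
  rewrite -(ge0_integral_mscale (lebesgue_rV m) mA (NngNum lm0) (@measurable_riesz 0 A)); last first.
    by move=> xi _; rewrite lee_fin powR_ge0.
  rewrite [RHS](eq_measure_integral (image_measure (lebesgue_rV m) (measurable_scale l))); last first.
    by move=> B mB _; rewrite /= /pushforward lebesgue_scale//.
  rewrite (ge0_integral_image (lebesgue_rV m) (measurable_scale l) mA (@measurable_riesz 0 A)).
    by [].
  by move=> xi; rewrite lee_fin powR_ge0.
have -> : l `^ (- alpha) = (l `^ (alpha - m%:R))^-1 * l ^- m.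
  rewrite -powRN -powR_invn ?ltW// -powRD; last by rewrite (gt_eqF l0) implybT.
  by congr (_ `^ _); ring.
rewrite EFinM -muleA -H -ge0_integralZl//=.
- apply: eq_integral => xi _; rewrite -EFinM; congr EFin.
  rewrite !sub0r !enormN enormZ gtr0_norm// powRM ?enorm_ge0 ?ltW//.
  by rewrite mulrA mulVf ?mul1r// gt_eqF// powR_gt0.
- exact: measurable_preimage (measurable_scale l) mA.
- by apply: measurable_funTS; exact: (measurableT_comp (@measurable_riesz 0 setT) (measurable_scale l)).
- by move=> xi _; rewrite lee_fin powR_ge0.
- by rewrite lee_fin invr_ge0 powR_ge0.
Qed.

End riesz.

(** * The Riesz kernel on annuli *)

Section annulus.
Context {R : realType} {m : nat}.
Hypothesis m0 : (0 < m)%N.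
Implicit Types (A B : set 'rV[R]_m) (x y : 'rV[R]_m).

Definition ball_volume : R := fine (lebesgue_rV m (eball 1 (0 : 'rV[R]_m))).

Lemma ball_volumeE : lebesgue_rV m (eball 1 (0 : 'rV[R]_m)) = ball_volume%:E.
Proof.
rewrite fineK// ge0_fin_numE; last exact: measure_ge0.
exact: lebesgue_eball_fin.
Qed.

Lemma ball_volume_gt0 : 0 < ball_volume.
Proof. by rewrite -lte_fin -ball_volumeE; exact: lebesgue_eball_gt0. Qed.

Lemma lebesgue_eball r x : 0 < r ->
  lebesgue_rV m (eball r x) = (r ^+ m * ball_volume)%:E.
Proof.
move=> r0; rewrite -(lebesgue_rV_translation x) ?measurable_eball//=; last exact: measurable_eball.
have ri : 0 <= r^-1 by rewrite invr_ge0 ltW.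
transitivity (lebesgue_rV m ((fun y => r^-1 *: y) @^-1` (eball 1 (0 : 'rV[R]_m)))).
  congr (lebesgue_rV m _); apply/seteqP; split=> y; rewrite /eball/= addrK subr0 enormZ;
    by rewrite (ger0_norm ri) ler_pdivrMl// mulr1.
rewrite lebesgue_scale ?invr_gt0//; last exact: measurable_eball.
by rewrite ball_volumeE -EFinM exprVn invrK.
Qed.

Lemma solid_cone_sphere : solid_cone (@sphere R m) = eball 1 0 `\ 0.
Proof.
apply/seteqP; split=> x.
  move=> [t [w [t0 t1 w1 ->]]]; split; rewrite /eball/=.
    by rewrite subr0 enormZ (w1 : _ = _) mulr1 gtr0_norm.
  move=> tw0; have := w1; rewrite /sphere/= => {}w1.
  have := enormZ t w; rewrite tw0 enorm0 w1 mulr1 gtr0_norm// => tE.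
  by move: t0; rewrite -tE ltxx.
move=> [/= x1 /eqP x0]; have xp := enorm_gt0 x0.
exists (enorm x), ((enorm x)^-1 *: x); split=> //.
- by move: x1; rewrite /eball/= subr0.
- by rewrite /sphere/= enormZ ger0_norm ?invr_ge0 ?ltW// mulVf// gt_eqF.
- by rewrite scalerA mulfV ?scale1r// gt_eqF.
Qed.

Lemma lebesgue_rV_set1 : lebesgue_rV m [set (0 : 'rV[R]_m)] = 0%E.
Proof.
transitivity (lebesgue_rV m [set y | forall i,
    `[(0 : 'rV[R]_m) ord0 i, (0 : 'rV[R]_m) ord0 i]%classic (y ord0 i)]); last first.
  rewrite lebesgue_rV_box//; under eq_bigr do rewrite subrr.
  by rewrite prodr_const card_ord expr0n; case: (m) m0.
congr (lebesgue_rV m _); apply/seteqP; split=> [y -> i|y y0].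
  by rewrite /= in_itv/= lexx.
apply/rowP => i; have := y0 i; rewrite /= in_itv/= => /andP[? ?].
by apply/eqP; rewrite eq_le; apply/andP.
Qed.

Lemma measurable_set1_rV x : measurable [set x].
Proof.
have -> : [set x] = eball 0 x; last exact: measurable_eball.
apply/seteqP; split=> y; rewrite /eball/=; first by move=> ->; rewrite subrr enorm0.
move=> yx; apply/eqP; rewrite -subr_eq0; apply/eqP/enorm_eq0/eqP.
by rewrite eq_le yx enorm_ge0.
Qed.

Lemma sphere_measureE : fine (sphere_measure (@sphere R m)) = m%:R * ball_volume.
Proof.
rewrite /sphere_measure solid_cone_sphere.
suff -> : lebesgue_rV m (eball 1 0 `\ (0 : 'rV[R]_m)) = ball_volume%:E by [].
rewrite -ball_volumeE -[in RHS](@setDUK _ [set 0] (eball 1 0)); last first.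
  by move=> x ->; rewrite /eball/= subrr enorm0.
rewrite measureU//; [|exact: measurable_set1_rV| |by rewrite setDIK].
  by rewrite [X in (_ = X + _)%E]lebesgue_rV_set1 add0e.
by apply: measurableD; [exact: measurable_eball|exact: measurable_set1_rV].
Qed.

Definition annulus a b x := eball b x `\` eball a x.

Lemma measurable_annulus a b x : measurable (annulus a b x).
Proof. by apply: measurableD; exact: measurable_eball. Qed.

Lemma annulusP a b x y : annulus a b x y <-> a < enorm (x - y) <= b.
Proof.
rewrite /annulus /eball/= (enormB x y); split=> [[-> /negP]|/andP[yx ->]].
  by rewrite -ltNge => ->.
by split=> //; apply/negP; rewrite -ltNge.
Qed.

Lemma annulusU a b c x : a <= b -> b <= c -> annulus a c x = annulus a b x `|` annulus b c x.
Proof.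
move=> ab bc; apply/seteqP; split=> y.
  move/annulusP => /andP[ay yc]; have [yb|yb] := leP (enorm (x - y)) b.
    by left; apply/annulusP; rewrite ay.
  by right; apply/annulusP; rewrite yb.
case=> /annulusP/andP[? ?]; apply/annulusP/andP; split=> //.
  exact: le_trans bc.
exact: le_lt_trans ab _.
Qed.

Lemma annulusI a b c x : annulus a b x `&` annulus b c x = set0.
Proof.
apply/seteqP; split=> // y [/annulusP/andP[_ yb] /annulusP/andP[by_ _]].
by move: (le_lt_trans yb by_); rewrite ltxx.
Qed.

Lemma lebesgue_annulus a b x : 0 < a -> a <= b ->
  lebesgue_rV m (annulus a b x) = (ball_volume * (b ^+ m - a ^+ m))%:E.
Proof.
move=> a0 ab; have b0 := lt_le_trans a0 ab.
have E (L : \bar R) c d : (c%:E + L)%E = d%:E -> L = (d - c)%:E.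
  by case: L => //= r [<-]; rewrite addrC addKr.
rewrite mulrC mulrBl; apply: E.
rewrite -(lebesgue_eball x b0) -(lebesgue_eball x a0) -measureU; first last.
- by rewrite setDIK.
- exact: measurable_annulus.
- exact: measurable_eball.
by rewrite setDUK// => y; rewrite /eball/= => /le_trans; apply.
Qed.

Variable alpha : R.
Hypothesis alpha0 : alpha <= 0.

(** The counter-terms S / (- alpha) * eps^alpha and S * log (1 / eps) of the
    potential are both - radial_primitive eps. *)
Definition radial_primitive (t : R) : R :=
  let S := fine (sphere_measure (@sphere R m)) in
  if alpha < 0 then S / alpha * t `^ alpha else S * ln t.
Local Notation k := radial_primitive.

Lemma radial_primitive_derive (t : R) : 0 < t ->
  is_derive t 1 k (ball_volume * t `^ (alpha - m%:R) * (m%:R * t ^+ m.-1)).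
Proof.
move=> t0.
have -> : ball_volume * t `^ (alpha - m%:R) * (m%:R * t ^+ m.-1) =
    fine (sphere_measure (@sphere R m)) * t `^ (alpha - 1).
  rewrite sphere_measureE.
  have -> : t `^ (alpha - 1) = t `^ (alpha - m%:R) * t ^+ m.-1.
    rewrite -powR_mulrn ?ltW// -powRD; last by rewrite (gt_eqF t0) implybT.
    by congr (_ `^ _); rewrite -subn1 natrB//; lra.
  ring.
rewrite /radial_primitive; have [an|an] := ltP alpha 0; last first.
  have -> : alpha = 0 by apply/eqP; rewrite eq_le alpha0.
  rewrite sub0r powR_inv1 ?ltW//.
  have := is_derive1_ln t0 => H.
  exact: is_deriveZ.
have := is_derive1_powR alpha t0 => H.
have := is_deriveZ (fine (sphere_measure (@sphere R m)) / alpha) H.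
rewrite /GRing.scale/= mulrA divfK// lt_eqF//.
Qed.

Lemma radial_primitive_continuous (t : R) : 0 < t -> {for t, continuous k}.
Proof.
move=> t0; apply: differentiable_continuous; apply/derivable1_diffP.
by have [] := radial_primitive_derive t0.
Qed.

(** Cauchy's mean value theorem for the primitive and t^m: the quotient of their
    derivatives at c is the volume of the unit ball times c^(alpha - m). *)
Lemma radial_primitive_bounds (s t : R) : 0 < s -> s <= t ->
  ball_volume * t `^ (alpha - m%:R) * (t ^+ m - s ^+ m) <= k t - k s <=
  ball_volume * s `^ (alpha - m%:R) * (t ^+ m - s ^+ m).
Proof.
move=> s0; rewrite le_eqVlt => /orP[/eqP <-|st]; first by rewrite !subrr !mulr0 lexx.
have pos c : c \in `]s, t[ -> 0 < c by rewrite in_itv/= => /andP[sc _]; exact: lt_trans sc.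
have [||c cst|c cst|c cst|c cst] := @cauchy_MVT R k
  (fun t => ball_volume * t `^ (alpha - m%:R) * (m%:R * t ^+ m.-1))
  (fun t => t ^+ m) (fun t => m%:R * t ^+ m.-1) s t st.
- apply: continuous_in_subspaceT => c; rewrite inE/= in_itv/= => /andP[sc _].
  by apply: radial_primitive_continuous; exact: lt_le_trans sc.
- by apply: continuous_subspaceT => c; exact: exprn_continuous.
- by apply: radial_primitive_derive; exact: pos.
- apply: DeriveDef; first exact: exprn_derivable.
  by rewrite exp_derive /GRing.scale/= mulr1.
- by rewrite gt_eqF// mulr_gt0 ?ltr0n// exprn_gt0// pos.
have c0 := pos _ cst.
rewrite mulfK; last by rewrite gt_eqF// mulr_gt0 ?ltr0n// exprn_gt0.
have stm : 0 < t ^+ m - s ^+ m by rewrite subr_gt0 ltr_pXn2r// ?nnegrE ltW// (lt_trans s0).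
move=> /(congr1 (fun z => z * (t ^+ m - s ^+ m))); rewrite divfK ?gt_eqF// => <-.
have p0 : alpha - m%:R <= 0 by rewrite subr_le0 (le_trans alpha0).
move: cst; rewrite in_itv/= => /andP[sc ct].
have v0 := ltW ball_volume_gt0.
by apply/andP; split; rewrite ler_wpM2r ?(ltW stm)// ler_wpM2l// powR_anti// ltW.
Qed.

Let p := alpha - m%:R.
Let alpham : alpha <= m%:R. Proof. by rewrite (le_trans alpha0). Qed.

(** On the shell between s and q s, the integral and the increment of the
    primitive lie between the same bounds, whose quotient is q^(alpha - m). *)
Lemma riesz_annulus_step q x s : 0 < s -> 1 <= q ->
  ((q `^ p * (k (q * s) - k s))%:E <= riesz alpha x (annulus s (q * s) x) <=
   (q `^ (- p) * (k (q * s) - k s))%:E)%E.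
Proof.
move=> s0 q1; have sq : s <= q * s by rewrite ler_peMl// ltW.
have q0 : 0 < q by lra.
have := radial_primitive_bounds s0 sq.
rewrite powRM ?(ltW q0) ?(ltW s0)// -/p.
have qp0 := powR_gt0 p q0; have sp0 := powR_gt0 p s0.
set d := k (q * s) - k s; set v := _ - s ^+ m => /andP[H1 H2].
apply/andP; split.
  apply: (@le_trans _ _ ((q * s) `^ p * (ball_volume * v))%:E).
    by rewrite lee_fin powRM ?(ltW q0) ?(ltW s0)//; nra.
  rewrite EFinM -(lebesgue_annulus x s0 sq); apply: riesz_ge => //.
    exact: measurable_annulus.
  by move=> y /annulusP/andP[sy ->]; rewrite andbT (lt_trans s0).
apply: (@le_trans _ _ (s `^ p * (ball_volume * v))%:E).
  rewrite EFinM -(lebesgue_annulus x s0 sq); apply: riesz_le => //.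
    exact: measurable_annulus.
  by move=> y /annulusP/andP[/ltW].
rewrite lee_fin powRN [leRHS]mulrC ler_pdivlMr//; nra.
Qed.

Lemma riesz_annulus_iter q x s N : 0 < s -> 1 <= q ->
  ((q `^ p * (k (q ^+ N * s) - k s))%:E <= riesz alpha x (annulus s (q ^+ N * s) x) <=
   (q `^ (- p) * (k (q ^+ N * s) - k s))%:E)%E.
Proof.
move=> s0 q1; elim: N => [|N /andP[IH1 IH2]].
  rewrite expr0 mul1r subrr !mulr0 /annulus setDv.
  by rewrite /riesz integral_set0 lexx.
have qN : 1 <= q ^+ N by rewrite exprn_ege1.
have sqN : 0 < q ^+ N * s by rewrite mulr_gt0// exprn_gt0//; lra.
have := riesz_annulus_step x sqN q1; rewrite mulrA -exprS => /andP[H1 H2].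
rewrite (@annulusU s (q ^+ N * s)).
- rewrite riesz_setU ?annulusI//; try exact: measurable_annulus.
  have E (c : R) : c * (k (q ^+ N.+1 * s) - k s) =
     c * (k (q ^+ N * s) - k s) + c * (k (q ^+ N.+1 * s) - k (q ^+ N * s)) by ring.
  by rewrite !E !EFinD; apply/andP; split; apply: leeD.
- by rewrite ler_peMl// ltW.
- by rewrite exprS -mulrA ler_peMl// ltW.
Qed.

Lemma le_expR_harmonic (w c d : R) :
  (forall N, w <= expR (c * N.+1%:R^-1) * d) -> w <= d.
Proof.
move=> H; have : (expR (c * harmonic N) * d @[N --> \oo]) --> expR (c * 0) * d.
  apply: cvgMl; apply: continuous_cvg; first exact: continuous_expR.
  by apply: cvgMr; exact: cvg_harmonic.
rewrite mulr0 expR0 mul1r => cd.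
rewrite -(cvg_lim _ cd)//; apply: limr_ge; first by apply/cvg_ex; exists d.
by apply: nearW.
Qed.

(** The radial integral, obtained without polar coordinates: on a thin shell
    the integrand is almost constant, and the volume of the shell and the
    increment of the primitive are comparable up to a ratio which tends to 1
    when the annulus is cut in more and more shells in geometric progression. *)
Lemma riesz_annulus x a b : 0 < a -> a <= b ->
  riesz alpha x (annulus a b x) = (k b - k a)%:E.
Proof.
move=> a0 ab; have b0 := lt_le_trans a0 ab.
pose c := - p * ln (b / a).
have ba1 : 1 <= b / a by rewrite ler_pdivlMr// mul1r.
have ba0 : 0 < b / a by lra.
have H N : ((expR (- c * N.+1%:R^-1) * (k b - k a))%:E <= riesz alpha x (annulus a b x) <=
   (expR (c * N.+1%:R^-1) * (k b - k a))%:E)%E.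
  pose q := (b / a) `^ (N.+1%:R^-1).
  have q1 : 1 <= q by rewrite -(powRr0 (b / a)) ler_powR.
  have := riesz_annulus_iter x N.+1 a0 q1.
  have -> : q ^+ N.+1 = b / a.
    by rewrite -powR_mulrn ?powR_ge0// -powRrM mulVf// powRr1// ltW.
  rewrite divfK ?gt_eqF// /q -!powRrM.
  rewrite /powR gt_eqF// (_ : _ * p * _ = - c * N.+1%:R^-1); last by rewrite /c; ring.
  by rewrite (_ : _ * - p * _ = c * N.+1%:R^-1)//; rewrite /c; ring.
have : riesz alpha x (annulus a b x) \is a fin_num.
  apply: (@riesz_fin _ _ _ _ _ _ a b) => //; first exact: measurable_annulus.
  by move=> y /annulusP/andP[/ltW -> ->].
move=> /fineK wE; move: H; rewrite -wE; set w := fine _ => H.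
congr EFin; apply/eqP; rewrite eq_le; apply/andP; split.
  by apply: (@le_expR_harmonic _ c) => N; have /andP[_] := H N; rewrite lee_fin.
apply: (@le_expR_harmonic _ c) => N; have /andP[+ _] := H N; rewrite lee_fin.
by rewrite mulNr expRN ler_pdivrMl// expR_gt0.
Qed.

End annulus.

(** * Reflections and the potential *)

Section reflection.
Context {R : realType} {m : nat}.
Implicit Types (A : set 'rV[R]_m) (v x y z : 'rV[R]_m) (b : R).

Lemma sphere_dotv v : sphere v -> dotv v v = 1.
Proof. by move=> v1; rewrite -sqr_enorm (v1 : _ = _) expr1n. Qed.

Lemma refl_dotv v b x : sphere v -> dotv (refl v b x) v = 2 * b - dotv x v.
Proof. by move=> /sphere_dotv v1; rewrite /refl !dotvE v1; ring. Qed.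

Lemma refl_comp v b c x : sphere v ->
  refl v c (refl v b x) = x + (2 * (c - b)) *: v.
Proof.
move=> sv; rewrite {1}/refl refl_dotv// /refl -addrA; congr (x + _).
by rewrite -opprD -scalerDl -scaleNr; congr (_ *: _); ring.
Qed.

Lemma reflK v b : sphere v -> involutive (refl v b).
Proof. by move=> sv x; rewrite refl_comp// subrr mulr0 scale0r addr0. Qed.

Lemma refl_orthogonal v : sphere v -> orthogonal (refl v 0).
Proof.
move=> sv; split=> [x y|a x|x y|].
- rewrite /refl !subr0 dotvDl mulrDr scalerDl opprD addrACA//.
- by rewrite /refl !subr0 dotvZl scalerBr scalerA mulrCA.
- by rewrite /refl !subr0 !dotvE (sphere_dotv sv) (dotvC v y); ring.
- by exists (refl v 0); exact: reflK.
Qed.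

Lemma reflE v b x : refl v b x = refl v 0 x + (2 * b) *: v.
Proof. by rewrite /refl subr0 -addrA; congr (_ + _); rewrite addrC -scalerBl -scaleNr; congr (_ *: _); ring. Qed.

Lemma enorm_refl v b x y : sphere v -> enorm (refl v b x - refl v b y) = enorm (x - y).
Proof.
move=> sv; rewrite (reflE v b x) (reflE v b y) opprD addrACA subrr addr0.
by rewrite -(orthB x y (refl_orthogonal sv)) (orth_enorm _ (refl_orthogonal sv)).
Qed.

Lemma measurable_refl v b : sphere v -> measurable_fun setT (refl v b).
Proof.
move=> sv; rewrite (_ : refl v b = fun x => refl v 0 x + (2 * b) *: v); last by apply/funext => x; exact: reflE.
apply: measurable_rV_add; last exact: measurable_cst.
exact: measurable_orth (refl_orthogonal sv).
Qed.

Lemma lebesgue_refl v b A : sphere v -> measurable A ->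
  lebesgue_rV m (refl v b @^-1` A) = lebesgue_rV m A.
Proof.
move=> sv mA; rewrite -[RHS](lebesgue_rV_translation ((2 * b) *: v) mA).
rewrite -[RHS](lebesgue_orth (refl_orthogonal sv)); last first.
  exact: measurable_preimage (measurable_addr _) mA.
by congr (lebesgue_rV m _); apply/seteqP; split=> x /=; rewrite (reflE v b).
Qed.

Lemma riesz_refl alpha v b x A : sphere v -> measurable A ->
  riesz alpha x (refl v b @^-1` A) = riesz alpha (refl v b x) A.
Proof.
move=> sv mA; apply: riesz_preimage => //; first exact: measurable_refl.
- by move=> B mB; exact: lebesgue_refl.
- by move=> y z; exact: enorm_refl.
Qed.

Lemma refl_closer v b x y : sphere v -> b < dotv x v -> dotv y v < b ->
  enorm (refl v b x - y) < enorm (x - y).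
Proof.
move=> sv bx yb; rewrite -(@ltr_pXn2r _ 2)// ?nnegrE ?enorm_ge0// !sqr_enorm.
rewrite /refl !dotvE (sphere_dotv sv) (dotvC v x) (dotvC v y) (dotvC y x).
by nra.
Qed.

End reflection.

Section potential.
Context {R : realType} {m : nat}.
Hypothesis m0 : (0 < m)%N.
Variable alpha : R.
Hypothesis alpha0 : alpha <= 0.
Implicit Types (A Omega : set 'rV[R]_m) (x y : 'rV[R]_m).
Local Notation k := (@radial_primitive R m alpha).

Let alpham : alpha <= m%:R. Proof. by rewrite (le_trans alpha0). Qed.

Lemma riesz_hole_fin Omega M x e : measurable Omega -> Omega `<=` eball M x ->
  0 < e -> riesz alpha x (Omega `\` eball e x) \is a fin_num.
Proof.
move=> mO OM e0; apply: (@riesz_fin _ _ _ alpham _ _ e M) => //.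
  by apply: measurableD => //; exact: measurable_eball.
move=> y [/OM]; rewrite /eball/= enormB => -> /negP.
by rewrite -ltNge andbT enormB => /ltW.
Qed.

(** Shrinking the hole from radius e to radius eps adds an annulus, whose
    integral is exactly what the counter-term removes; so the limit defining the
    potential is attained as soon as the hole lies inside Omega. *)
Lemma potentialE Omega M x e : measurable Omega -> Omega `<=` eball M x ->
  0 < e -> eball e x `<=` Omega ->
  potential alpha Omega x = fine (riesz alpha x (Omega `\` eball e x)) + k e.
Proof.
move=> mO OM e0 eO.
pose I eps := fine (riesz alpha x (Omega `\` eball eps x)).
have H eps : 0 < eps -> eps <= e -> I eps + k eps = I e + k e.
  move=> eps0 epse; rewrite /I.
  have -> : Omega `\` eball eps x = (Omega `\` eball e x) `|` annulus eps e x.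
    apply/seteqP; split=> y.
      move=> [Oy /negP]; rewrite /eball/= -ltNge => epsy.
      have [ye|ye] := leP (enorm (y - x)) e.
        by right; apply/annulusP; rewrite enormB epsy.
      by left; split=> //; apply/negP; rewrite /eball/= -ltNge.
    case=> [[Oy ye]|/annulusP/andP[ye ey]].
      by split=> // yeps; apply: ye; rewrite /eball/= (le_trans yeps).
    split; first by apply: eO; rewrite /eball/= enormB.
    by apply/negP; rewrite -ltNge enormB.
  rewrite riesz_setU.
  - rewrite (riesz_annulus m0 alpha0)// fineD ?(riesz_hole_fin mO OM)//=; lra.
  - by apply: measurableD => //; exact: measurable_eball.
  - exact: measurable_annulus.
  - apply/seteqP; split=> // y [[_ /negP ye] /annulusP/andP[_]].
    by rewrite enormB; exact/negP.
have near_H : \forall eps \near 0^'+, 0 < eps /\ I eps + k eps = I e + k e.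
  near=> eps; have eps0 : 0 < eps by [].
  by split=> //; apply: H => //; near: eps; exact: nbhs_right_le.
rewrite /potential/= -[RHS]/(I e + k e); case: ifPn => [an|/negbTE an].
  apply: norm_lim_near_cst; apply: filterS near_H => eps [_ <-].
  by congr (_ + _); rewrite /radial_primitive an invrN mulrN mulNr opprK.
apply: norm_lim_near_cst; apply: filterS near_H => eps [eps0 <-].
by congr (_ + _); rewrite /radial_primitive an lnV ?posrE// mulrN opprK.
Unshelve. all: by end_near. Qed.

Lemma le_riesz_center x y A : measurable A ->
  (forall xi, A xi -> 0 < enorm (y - xi) <= enorm (x - xi)) ->
  (riesz alpha x A <= riesz alpha y A)%E.
Proof.
move=> mA Axy; apply: ge0_le_integral => //.
- by move=> xi _; rewrite lee_fin powR_ge0.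
- exact: measurable_riesz.
- exact: measurable_riesz.
- by move=> xi /Axy/andP[? ?]; rewrite lee_fin powR_anti// subr_le0.
Qed.

Lemma powR_anti_lt (p s t : R) : p < 0 -> 0 < s -> s < t -> t `^ p < s `^ p.
Proof.
move=> p0 s0 st; have t0 := lt_trans s0 st.
rewrite -[p]opprK !(powRN _ (- p)) ltf_pV2 ?posrE ?powR_gt0//.
by apply: gt0_ltr_powR; rewrite ?oppr_gt0// ?nnegrE ltW.
Qed.

(** Around u there is a small ball on which the distance to y stays below a
    constant which is smaller than all distances to x; strictness comes from this
    ball, and the rest is compared pointwise. *)
Lemma lt_riesz_center x y A (u : 'rV[R]_m) e M : measurable A ->
  0 < e ->
  (forall xi, A xi -> e <= enorm (y - xi) <= M) ->
  (forall xi, A xi -> enorm (y - xi) < enorm (x - xi)) -> nbhs u A ->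
  (riesz alpha x A < riesz alpha y A)%E.
Proof.
move=> mA e0 Ae Axy uA; have Au := nbhs_singleton uA.
have yxu := Axy _ Au; set d1 := enorm (y - u) in yxu; set d2 := enorm (x - u) in yxu.
have [r r0 rA] := (nbhs_eballP u A).1 uA.
pose s := Num.min r ((d2 - d1) / 3).
have s0 : 0 < s by rewrite lt_min r0/= divr_gt0// subr_gt0.
have sd : s <= (d2 - d1) / 3 by rewrite ge_min lexx orbT.
pose N := eball s u.
have NA : N `<=` A.
  by move=> z zs; apply: rA; rewrite /eball/= (le_trans zs)// ge_min lexx.
have mN : measurable N by exact: measurable_eball.
have mAN : measurable (A `\` N) by exact: measurableD.
have riesz_split z : riesz alpha z A = (riesz alpha z N + riesz alpha z (A `\` N))%E.
  by rewrite -riesz_setU ?setDUK// setDIK.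
have d10 : 0 < d1 + s by rewrite ltr_wpDl// enorm_ge0.
have lN0 : (0 < lebesgue_rV m N)%E by exact: lebesgue_eball_gt0.
have lNoo : lebesgue_rV m N \is a fin_num.
  by rewrite ge0_fin_numE ?(ltW lN0)//; exact: lebesgue_eball_fin.
rewrite !riesz_split; apply: lte_leD.
- apply: (@riesz_fin _ _ _ alpham _ _ e (M + enorm (x - y))) => //.
  move=> xi [Axi _]; have /andP[? ?] := Ae _ Axi; have := Axy _ Axi => ?.
  by apply/andP; split; [lra|have := ler_enormB x y xi; lra].
- apply: (@le_lt_trans _ _ (((d2 - s) `^ (alpha - m%:R))%:E * lebesgue_rV m N)%E).
    apply: riesz_le => //; first lra.
    move=> xi; rewrite /N /eball/= => xis.
    by have := ler_enormB x xi u; rewrite -/d2; lra.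
  apply: (@lt_le_trans _ _ (((d1 + s) `^ (alpha - m%:R))%:E * lebesgue_rV m N)%E).
    rewrite lte_pmul2r// lte_fin powR_anti_lt//; last lra.
    by rewrite subr_lt0 (le_lt_trans alpha0)// ltr0n.
  apply: riesz_ge => // xi Nxi; have /andP[? ?] := Ae _ (NA _ Nxi).
  move: Nxi; rewrite /N /eball/= => xis; apply/andP; split; first lra.
  by have := ler_enormB y u xi; rewrite -/d1 (enormB u); lra.
- apply: le_riesz_center => // xi [Axi _].
  have /andP[? ?] := Ae _ Axi; have := Axy _ Axi => ?.
  by apply/andP; split; lra.
Qed.

End potential.

(** * Bodies and the minimal unfolded region *)

Section body.
Context {R : realType} {m : nat}.
Implicit Types (A B Omega : set 'rV[R]_m) (x y z : 'rV[R]_m).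

Lemma body_closed Omega : body Omega -> closed Omega.
Proof. by move=> [U [_ _ ->]]; exact: closed_closure. Qed.

Lemma body_bounded Omega : body Omega -> exists M : R, forall z, Omega z -> enorm z <= M.
Proof.
move=> [U [_ /bounded_enormP[M UM] ->]]; exists M => z Uz.
have : closure U `<=` eball M 0.
  have /closure_id -> := @eball_closed R m M 0.
  by apply: closure_subset => u /UM; rewrite /eball/= subr0.
by move=> /(_ _ Uz); rewrite /eball/= subr0.
Qed.

(** A nonempty piece of a body cut out by an open set has interior points, hence
    positive volume. *)
Lemma body_dense Omega (z : 'rV[R]_m) B : body Omega -> Omega z -> nbhs z B ->
  exists u : 'rV[R]_m, nbhs u (Omega `&` B).
Proof.
move=> [U [oU _ ->]] Uz zB.
have [u [Uu Bu]] := Uz _ (open_nbhs_nbhs (conj (@open_interior _ B) zB)).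
exists u; apply: filterI; last exact: Bu.
by apply: filterS (open_nbhs_nbhs (conj oU Uu)); exact: subset_closure.
Qed.

Lemma body_measurable Omega : body Omega -> measurable Omega.
Proof. by move=> /body_closed; exact: closed_measurable_rV. Qed.

Lemma bounded_eball Omega M x : (forall z, Omega z -> enorm z <= M) ->
  Omega `<=` eball (M + enorm x) x.
Proof.
move=> OM z /OM zM; rewrite /eball/=.
by have := enormD z (- x); rewrite enormN; lra.
Qed.

End body.

Section moving_plane.
Context {R : realType} {m : nat}.
Hypothesis m0 : (0 < m)%N.
Variable alpha : R.
Hypothesis alpha0 : alpha <= 0.
Variable Omega : set 'rV[R]_m.
Hypothesis bO : body Omega.
Implicit Types (A B : set 'rV[R]_m) (x y z v : 'rV[R]_m).

(** Moving planes. Let S be the points of Omega whose mirror image is in Omega, and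
    N the others. By symmetry S contributes equally to both potentials. The points
    of N lie on the side of the mirror image of x, hence are closer to it than to
    x; and N contains a small ball as soon as it is nonempty, because points of a
    body are limits of interior points. *)
Lemma refl_potential_lt v b x : sphere v -> b < dotv x v -> Omega° x ->
  refl v b @` cap Omega v b `<=` Omega ->
  ~ (refl v b @` Omega `<=` Omega) ->
  Omega° (refl v b x) /\ potential alpha Omega x < potential alpha Omega (refl v b x).
Proof.
move=> sv bx Ox capO nO; set x' := refl v b x.
have [M OM] := body_bounded bO; have mO := body_measurable bO.
have rK := reflK b sv.
have capO' y : Omega y -> b <= dotv y v -> Omega (refl v b y).
  by move=> Oy yb; apply: capO; exists y.
have refl_eball e y z : eball e y (refl v b z) = eball e (refl v b y) z.
  by rewrite /eball/= -(enorm_refl b _ _ sv) rK.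
pose S := Omega `&` (refl v b @^-1` Omega).
pose N := Omega `\` (refl v b @^-1` Omega).
have mr : measurable (refl v b @^-1` Omega).
  by apply: measurable_preimage mO; exact: measurable_refl.
have mS : measurable S by exact: measurableI.
have mN : measurable N by exact: measurableD.
have Nb xi : N xi -> dotv xi v < b.
  by move=> [Oxi nr]; rewrite ltNge; apply/negP => /(capO' _ Oxi).
have [u uN] : exists u : 'rV[R]_m, nbhs u N.
  have [z [Oz nz]] : exists z, Omega z /\ ~ Omega (refl v b z).
    apply/not_existsP => H; apply: nO => _ [z Oz <-].
    by apply: contrapT => nz; apply: (H z).
  apply: (body_dense bO Oz).
  have : nbhs (refl v b z) (~` Omega).
    apply: open_nbhs_nbhs; split=> //; rewrite openC; exact: body_closed.
  move=> /nbhs_eballP[e e0 eO]; apply/nbhs_eballP; exists e => // y zy.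
  by apply: eO; rewrite -refl_eball rK.
have [e [e0 eS e'S]] : exists e, [/\ 0 < e, eball e x `<=` S & eball e x' `<=` S].
  have [d d0 dO] := (nbhs_eballP x Omega).1 Ox.
  pose e := Num.min d ((dotv x v - b) / 2).
  have e0 : 0 < e by rewrite lt_min d0 divr_gt0// subr_gt0.
  have ed : e <= d by rewrite ge_min lexx.
  have eb : e <= (dotv x v - b) / 2 by rewrite ge_min lexx orbT.
  have H y : eball e x y -> Omega y /\ Omega (refl v b y).
    move=> xy; have Oy : Omega y by apply: dO; exact: le_trans ed.
    split=> //; apply: capO' => //.
    have := cauchy_schwarz (x - y) v; rewrite (sv : _ = _) mulr1 dotvBl.
    by rewrite enormB; move: xy; rewrite /eball/=; lra.
  exists e; split=> // y xy.
  by have [] := H (refl v b y); rewrite ?refl_eball// rK.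
have split_hole z : eball e z `<=` S ->
    riesz alpha z (Omega `\` eball e z) =
    (riesz alpha z (S `\` eball e z) + riesz alpha z N)%E.
  move=> zS; rewrite -riesz_setU//.
  - congr riesz; apply/seteqP; split=> y.
      move=> [Oy yz]; have [ry|ry] := pselect (Omega (refl v b y)).
        by left; split=> //; split.
      by right.
    by move=> [[[Oy _] yz]//|[Oy ny]]; split=> // /zS[].
  - by apply: measurableD => //; exact: measurable_eball.
  - by apply/seteqP; split=> // y [[[_ ry] _] [_ nry]].
have Ox' : Omega° x'.
  by apply/nbhs_eballP; exists e => // y /e'S[].
split; first exact: Ox'.
have OMx z := bounded_eball z OM.
rewrite !(potentialE m0 alpha0 mO (OMx _) e0); try by move=> y /eS[] || by move=> y /e'S[].
have hole_fin z := riesz_hole_fin alpha0 mO (OMx z) e0.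
rewrite ltrD2r; apply: fine_lt => //; rewrite !split_hole//.
have SE : riesz alpha x' (S `\` eball e x') = riesz alpha x (S `\` eball e x).
  have mSe : measurable (S `\` eball e x').
    by apply: measurableD => //; exact: measurable_eball.
  apply: (etrans (esym (riesz_refl alpha b x sv mSe))).
  congr riesz; apply/seteqP; split=> y.
    by move=> [[/= ry]]; rewrite rK => Oy; rewrite refl_eball rK.
  by move=> [[/= Oy ry] yx]; split; [split=> //=; rewrite rK|rewrite /= refl_eball rK].
rewrite SE lteD2lE; last first.
  apply: (riesz_hole_fin alpha0 mS _ e0) => y [/OMx]; exact.
have xiN xi : N xi -> e <= enorm (x' - xi) <= M + enorm x'.
  move=> Nxi; apply/andP; split; last first.
    by rewrite enormB; apply: (OMx x'); case: Nxi.
  rewrite leNgt; apply/negP => xie; have [_ nr] := Nxi.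
  have := e'S xi; rewrite /eball/= enormB => /(_ (ltW xie))[_ ry].
  exact: nr.
have xiNx xi : N xi -> enorm (x' - xi) < enorm (x - xi).
  by move=> /Nb; exact: refl_closer.
exact: (@lt_riesz_center R m m0 alpha alpha0 x x' N u e _ mN e0 xiN xiNx uN).
Qed.

(** Above Omega the condition is void, so levels exist; below Omega, a reflection
    would send every point of Omega further down, out of Omega. *)
Lemma level_has_inf v x : sphere v -> Omega x ->
  has_inf [set a | forall b, a <= b -> refl v b @` cap Omega v b `<=` Omega].
Proof.
move=> sv Ox; have [M OM] := body_bounded bO.
have OMv z : Omega z -> `|dotv z v| <= M.
  move=> Oz; apply: le_trans (OM _ Oz); rewrite ler_norml.
  have := cauchy_schwarz z v; have := cauchy_schwarz (- z) v.
  by rewrite enormN (sv : _ = _) mulr1 dotvNl => ? ?; apply/andP; split; lra.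
split.
  exists (M + 1) => b Mb y [z [Oz /= bz] _].
  by have := OMv _ Oz; rewrite ler_norml => /andP[_ ?]; lra.
exists (- M) => a /= aO; rewrite leNgt; apply/negP => aM.
have := OMv _ Ox; rewrite ler_norml => /andP[xM _].
have : Omega (refl v a x).
  by apply: (aO a) => //; exists x => //; split=> //=; lra.
by move=> /OMv; rewrite refl_dotv// ler_norml => /andP[? _]; lra.
Qed.

Lemma not_translation_stable v h x : sphere v -> 0 < h -> Omega x ->
  ~ (forall z, Omega z -> Omega (z + h *: v)).
Proof.
move=> sv h0 Ox H; have [M OM] := body_bounded bO.
have Hn n : Omega (x + (n%:R * h) *: v).
  elim: n => [|n IH]; first by rewrite mul0r scale0r addr0.
  by have := H _ IH; rewrite -addrA -scalerDl -natr1 mulrDl mul1r.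
pose n := (Num.trunc ((M + enorm x) / h)).+1.
have : M + enorm x < n%:R * h by rewrite -ltr_pdivrMr// truncnS_gt.
have := OM _ (Hn n); have := enormD (x + (n%:R * h) *: v) (- x).
rewrite addrC addKr enormN enormZ (sv : _ = _) mulr1.
by have := ler_norm (n%:R * h); lra.
Qed.

(** If a center lay beyond the level l(v), [refl_potential_lt] would make Omega
    stable under the reflections at two different heights, hence under their
    composition, a translation along v. *)
Lemma center_Uf x : is_center alpha Omega x -> Uf Omega x.
Proof.
move=> [Ox xmax] v sv; rewrite leNgt; apply/negP => lx.
have OOx := interior_subset Ox.
have [a aO ax] : exists2 a, (forall b, a <= b -> refl v b @` cap Omega v b `<=` Omega) & a < dotv x v.
  have e0 : 0 < dotv x v - level Omega v by rewrite subr_gt0.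
  have [a aO ax] := inf_adherent e0 (level_has_inf sv OOx).
  by exists a => //; move: ax; rewrite -/(level Omega v); lra.
have stable b : a <= b -> b < dotv x v -> forall z, Omega z -> Omega (refl v b z).
  move=> ab bx z Oz; have [|nO] := pselect (refl v b @` Omega `<=` Omega).
    by apply; exists z.
  have [Orx] := refl_potential_lt sv bx Ox (aO b ab) nO.
  by rewrite ltNge (xmax _ Orx).
pose c := (a + dotv x v) / 2.
have ac : a < c by rewrite /c; lra.
have cx : c < dotv x v by rewrite /c; lra.
apply: (@not_translation_stable v (2 * (c - a)) x sv _ OOx); first lra.
move=> z Oz; rewrite -refl_comp//; apply: (stable c) => //; first exact: ltW.
by apply: stable; rewrite ?lexx.
Qed.

End moving_plane.

(** * Distances, rotations and cones *)

Section dist.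
Context {R : realType} {m : nat}.
Hypothesis m0 : (0 < m)%N.
Variable Omega : set 'rV[R]_m.
Hypothesis bO : body Omega.
Implicit Types (A B : set 'rV[R]_m) (x y z v w : 'rV[R]_m).

Lemma dist_lbound x A : has_lbound [set enorm (x - a) | a in A].
Proof. by exists 0 => _ [a _ <-]; exact: enorm_ge0. Qed.

Lemma dist_le x A a : A a -> dist x A <= enorm (x - a).
Proof. by move=> Aa; apply: ge_inf; [exact: dist_lbound|exists a]. Qed.

Lemma dist_ge x A r : A !=set0 -> (forall a, A a -> r <= enorm (x - a)) -> r <= dist x A.
Proof.
move=> [a Aa] H; apply: lb_le_inf; first by exists (enorm (x - a)), a.
by move=> _ [b Ab <-]; exact: H.
Qed.

Lemma in_dist_setC x y : enorm (x - y) < dist x (~` Omega) -> Omega y.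
Proof.
by move=> xy; apply: contrapT => nOy; move: xy; rewrite ltNge dist_le.
Qed.

Lemma body_setC : ~` Omega !=set0.
Proof.
have [M OM] := body_bounded bO; pose w : 'rV[R]_m := const_mx (`|M| + 1).
exists w => /OM; have := abs_coord_le_enorm w (Ordinal m0).
by rewrite mxE ger0_norm ?addr_ge0//; have := ler_norm M; lra.
Qed.

Lemma dist_gt0 x : Omega° x -> 0 < dist x (~` Omega).
Proof.
move=> /nbhs_eballP[e e0 eO]; apply: lt_le_trans (e0) _; apply: dist_ge.
  exact: body_setC.
move=> a nOa; rewrite leNgt; apply/negP => xa; apply: nOa; apply: eO.
by rewrite /eball/= enormB ltW.
Qed.

(** A minimizer z of the distance to x over the closure of the complement. It
    belongs to Omega: otherwise, the complement being open, z could be moved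
    towards x inside the complement. *)
Lemma nearest_boundary x : Omega° x -> exists z,
  [/\ enorm (z - x) = dist x (~` Omega), Omega z &
      (closure (~` Omega) `\` (~` Omega)°) z].
Proof.
move=> Ox; have [w nOw] := body_setC; set r := dist _ _.
pose K := closure (~` Omega) `&` eball (enorm (w - x)) x.
have cK : compact K.
  by rewrite /K setIC; apply: compact_closedI; [exact: eball_compact|exact: closed_closure].
have K0 : K !=set0.
  by exists w; split; [exact: subset_closure|rewrite /eball/=].
have [|z Kz zmin] := @compact_EVT_min _ _ (fun y => enorm (y - x)) K K0 cK.
  by apply: continuous_subspaceT; exact: enorm_continuous.
have zr : enorm (z - x) <= r.
  apply: dist_ge; first exact: body_setC.
  move=> a nOa; rewrite (enormB x a).
  have [aw|aw] := leP (enorm (a - x)) (enorm (w - x)).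
    by apply: zmin; rewrite inE; split=> //; exact: subset_closure.
  by apply: le_trans (ltW aw); apply: zmin; rewrite inE; split=> //; [exact: subset_closure|rewrite /eball/=].
have cz : closure (~` Omega) z by case: (set_mem Kz).
have rz : r <= enorm (z - x).
  rewrite leNgt; apply/negP => zr'.
  have : nbhs z Omega.
    apply/nbhs_eballP; exists ((r - enorm (z - x)) / 2); first by rewrite divr_gt0// subr_gt0.
    move=> y; rewrite /eball/= => yz; apply: (@in_dist_setC x); rewrite -/r enormB.
    by have := ler_enormB y z x; lra.
  by move=> /cz[y []].
have Oz : Omega z.
  apply: contrapT => nOz.
  have : nbhs z (~` Omega).
    by apply: open_nbhs_nbhs; split=> //; rewrite openC; exact: body_closed.
  move=> /nbhs_eballP[e e0 eO].
  have r0 : 0 < r := dist_gt0 Ox.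
  pose t := Num.min (e / r) (1 / 2).
  have t0 : 0 < t by rewrite lt_min !divr_gt0.
  have t1 : t <= 1 / 2 by rewrite ge_min lexx orbT.
  have te : t * r <= e by rewrite -ler_pdivlMr// ge_min lexx.
  have := eO (z - t *: (z - x)); apply.
    rewrite /eball/= addrC addKr enormN enormZ gtr0_norm//.
    by apply: le_trans te; rewrite ler_pM2l.
  apply: (@in_dist_setC x); rewrite -/r enormB.
  rewrite (_ : _ - x = (1 - t) *: (z - x)); last first.
    by rewrite scalerBl scale1r addrAC.
  rewrite enormZ ger0_norm; last by lra.
  by have := t0; nra.
exists z; split=> //; first by apply/eqP; rewrite eq_le zr rz.
by split=> // /interior_subset.
Qed.

Lemma enorm_le_diam x y : Omega x -> Omega y -> enorm (x - y) <= diam Omega.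
Proof.
move=> Ox Oy; have [M OM] := body_bounded bO.
apply: ub_le_sup; last by exists (x, y).
exists (M + M) => _ [[a b] [/= Oa Ob] <-].
have := enormD a (- b); rewrite enormN.
by have := OM _ Oa; have := OM _ Ob; lra.
Qed.

Lemma dist_le_diam x : Omega x -> dist x (~` Omega) <= diam Omega.
Proof.
move=> Ox; rewrite leNgt; apply/negP => dx.
pose t := (dist x (~` Omega) + diam Omega) / 2.
pose e : 'rV[R]_m := delta_mx ord0 (Ordinal m0).
have e1 : enorm e = 1 by rewrite /enorm dotv_delta mxE !eqxx sqrtr1.
have D0 : 0 <= diam Omega by have := enorm_le_diam Ox Ox; rewrite subrr enorm0.
have E : enorm (x - (x + t *: e)) = t.
  by rewrite opprD addrA subrr sub0r enormN enormZ e1 mulr1 ger0_norm// /t; lra.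
have Oxt : Omega (x + t *: e) by apply: (@in_dist_setC x); rewrite E /t; lra.
by have := enorm_le_diam Ox Oxt; rewrite E /t; lra.
Qed.

Lemma inradius_has_sup x : Omega x ->
  has_sup [set dist xi (~` Omega) | xi in Omega].
Proof.
move=> Ox; split; first by exists (dist x (~` Omega)), x.
by exists (diam Omega) => _ [y Oy <-]; exact: dist_le_diam.
Qed.

Lemma dist_le_inradius x : Omega x -> dist x (~` Omega) <= inradius Omega.
Proof. by move=> Ox; apply: ub_le_sup; [case: (inradius_has_sup Ox)|exists x]. Qed.

Lemma inradius_le_diam x : Omega x -> inradius Omega <= diam Omega.
Proof.
move=> Ox; apply: ge_sup; first by case: (inradius_has_sup Ox).
by move=> _ [y Oy <-]; exact: dist_le_diam.
Qed.

Lemma inradius_adherent x s : Omega x -> s < inradius Omega ->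
  exists y, eball s y `<=` Omega.
Proof.
move=> Ox sR; have e0 : 0 < inradius Omega - s by rewrite subr_gt0.
have [_ [y Oy <-]] := sup_adherent e0 (inradius_has_sup Ox).
rewrite -/(inradius Omega) subKr => sy; exists y => z zy.
by apply: (@in_dist_setC y); apply: le_lt_trans sy; rewrite enormB.
Qed.

End dist.

Section rotation.
Context {R : realType} {m : nat}.
Implicit Types (a b x y z v w : 'rV[R]_m).

(** The Householder reflection in the hyperplane bisecting a and b. *)
Lemma orthogonal_swap a b : dotv a a = dotv b b -> exists T,
  [/\ orthogonal T, T a = b & forall y, dotv y (a - b) = 0 -> T y = y].
Proof.
move=> ab; have [->|nab] := eqVneq a b; first by exists id; split=> //; exact: orth_id.
have d0 : 0 < enorm (a - b) by apply: enorm_gt0; rewrite subr_eq0.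
pose u := (enorm (a - b))^-1 *: (a - b).
have su : sphere u.
  by rewrite /sphere/= enormZ ger0_norm ?invr_ge0 ?ltW// mulVf// gt_eqF.
exists (refl u 0); split; first exact: refl_orthogonal.
  rewrite /refl subr0 /u dotvZr scalerA.
  have -> : 2 * ((enorm (a - b))^-1 * dotv a (a - b)) / enorm (a - b) = 1.
    have -> : 2 * ((enorm (a - b))^-1 * dotv a (a - b)) / enorm (a - b) =
      2 * dotv a (a - b) / enorm (a - b) ^+ 2.
      by field; rewrite gt_eqF.
    rewrite sqr_enorm; have -> : 2 * dotv a (a - b) = dotv (a - b) (a - b).
      by rewrite !dotvE -ab (dotvC b a); ring.
    by rewrite mulfV// -sqr_enorm expf_neq0// gt_eqF.
  by rewrite scale1r subKr.
by move=> y yab; rewrite /refl /u dotvZr yab mulr0 subr0 mulr0 scale0r subr0.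
Qed.

(** First move a to e; then move the image of b to the required vector. Both have
    the same scalar product with e, so their difference is orthogonal to e, and the
    second reflection fixes e. *)
Lemma rotation_pair a b e f : sphere a -> sphere b -> sphere e -> sphere f ->
  dotv e f = 0 -> exists T, [/\ orthogonal T, T a = e &
    T b = cos (acos (dotv a b)) *: e + sin (acos (dotv a b)) *: f].
Proof.
move=> /sphere_dotv a1 /sphere_dotv b1 /sphere_dotv e1 /sphere_dotv f1 ef.
have [T [oT Ta _]] := @orthogonal_swap a e (etrans a1 (esym e1)).
set t := acos _.
have ct : cos t = dotv a b.
  rewrite /t acosK// in_itv/=.
  have na : enorm a = 1 by rewrite /enorm a1 sqrtr1.
  have nb : enorm b = 1 by rewrite /enorm b1 sqrtr1.
  have := cauchy_schwarz (- a) b; have := cauchy_schwarz a b.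
  by rewrite enormN na nb dotvNl => ? ?; apply/andP; split; lra.
pose c := cos t *: e + sin t *: f.
have c1 : dotv c c = 1.
  by rewrite /c !dotvE e1 f1 (dotvC f e) ef -[RHS](cos2Dsin2 t); ring.
have [|U [oU Ub Ufix]] := @orthogonal_swap (T b) c.
  by rewrite (orth_dotv oT) b1 c1.
exists (U \o T); split; [exact: orth_comp| |exact: Ub].
rewrite /= Ta Ufix// dotvBr -Ta (orth_dotv oT) -ct Ta /c !dotvE e1 ef; ring.
Qed.

End rotation.

Section cones.
Context {R : realType} {m : nat}.
Implicit Types (x y z v w : 'rV[R]_m).

Lemma coneP x v kappa delta y : cone x v kappa delta y <->
  [/\ 0 < enorm (y - x), ((enorm (y - x))%:E < delta)%E &
      cos (kappa / 2) * enorm (y - x) < dotv (y - x) v].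
Proof.
split=> [[rho [w [r0 rd w1 wv ->]]]|[r0 rd yv]].
  rewrite addrC addKr enormZ (w1 : _ = _) mulr1 gtr0_norm// dotvZl.
  by split=> //; rewrite mulrC ltr_pM2l.
exists (enorm (y - x)), ((enorm (y - x))^-1 *: (y - x)); split=> //.
- by rewrite /sphere/= enormZ ger0_norm ?invr_ge0 ?ltW// mulVf// gt_eqF.
- by rewrite dotvZl ltr_pdivlMl// mulrC.
- by rewrite scalerA mulfV ?gt_eqF// scale1r addrC subrK.
Qed.

Lemma measurable_cone x v kappa delta : measurable (cone x v kappa delta).
Proof.
have -> : cone x v kappa delta =
    ((fun y => enorm (y - x)) @^-1` `]0, +oo[%classic) `&`
    ((fun y => (enorm (y - x))%:E) @^-1` `]-oo, delta[%classic) `&`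
    ((fun y => dotv y v - (dotv x v + cos (kappa / 2) * enorm (y - x))) @^-1` `]0, +oo[%classic).
  apply/seteqP; split=> y.
    move=> /coneP[H1 H2]; rewrite dotvBl => H3.
    split; first split; rewrite /= ?in_itv/= ?andbT//; lra.
  rewrite /= !in_itv/= !andbT => -[[H1 H2] H3].
  by apply/coneP; split=> //; rewrite dotvBl; lra.
have me := measurable_enormB x.
apply: measurableI; first apply: measurableI.
- exact: measurable_preimage me (measurable_itv _).
- by apply: measurable_preimage; [exact/measurable_EFinP|exact: emeasurable_itv].
- apply: measurable_preimage; last exact: measurable_itv.
  apply: measurable_funB; first exact: measurable_dotv.
  apply: measurable_funD; first exact: measurable_cst.
  by apply: measurable_funM => //; exact: measurable_cst.
Qed.

Lemma dotv_unit_vec i j : (i < m)%N ->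
  dotv (unit_vec R m i) (unit_vec R m j) = (i == j)%:R.
Proof.
move=> im; rewrite /dotv (bigD1 (Ordinal im))//= !mxE eqxx mul1r.
rewrite big1 ?addr0// => k ki; rewrite !mxE.
by rewrite (_ : (k == i :> nat) = false) ?mul0r//; apply/negbTE.
Qed.

End cones.

(** * Cones in standard position *)

Section cone_geometry.
Context {R : realType} {m : nat}.
Hypothesis m2 : (2 <= m)%N.
Implicit Types (x y z n v w : 'rV[R]_m).

Local Notation e1 := (unit_vec R m 0).
Local Notation em := (unit_vec R m m.-1).

Lemma sphere_unit_vec i : (i < m)%N -> sphere (unit_vec R m i).
Proof. by move=> im; rewrite /sphere/= /enorm dotv_unit_vec// eqxx sqrtr1. Qed.

Let m0 : (0 < m)%N. Proof. exact: ltnW. Qed.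
Let se1 : sphere e1. Proof. exact: sphere_unit_vec. Qed.
Let sem : sphere em. Proof. by apply: sphere_unit_vec; rewrite ltn_predL. Qed.
Let e1em : dotv e1 em = 0.
Proof. by rewrite dotv_unit_vec//; case: (m) m2 => [|[|]]. Qed.

Let vec (t : R) := cos t *: e1 + sin t *: em.

Let vec_dotv s t : dotv (vec s) (vec t) = cos (s - t).
Proof.
rewrite /vec !dotvE (sphere_dotv se1) (sphere_dotv sem) (dotvC em) e1em cosB.
ring.
Qed.

Let vec0 : vec 0 = e1.
Proof. by rewrite /vec cos0 sin0 scale1r scale0r addr0. Qed.

Let sphere_vec t : sphere (vec t).
Proof. by rewrite /sphere/= /enorm vec_dotv subrr cos0 sqrtr1. Qed.

(** Otherwise, turning the axis away from e1 by some angle less than kappa / 2 gives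
    a direction of the cone which makes an obtuse angle with e1. *)
Lemma angle_le (theta kappa : R) : 0 <= theta <= pi -> 0 < kappa <= pi ->
  (forall w, sphere w -> cos (kappa / 2) < dotv w (vec theta) -> 0 <= dotv w e1) ->
  theta <= (pi - kappa) / 2.
Proof.
move=> /andP[t0 tpi] /andP[k0 kpi] H; rewrite leNgt; apply/negP => tk.
have turn (phi : R) : 0 <= phi -> phi < kappa / 2 -> 0 <= cos (theta + phi).
  move=> p0 pk; have := H (vec (theta + phi)) (sphere_vec _).
  rewrite -vec0 !vec_dotv subr0 addrAC subrr add0r; apply.
  by rewrite ltr_cos// in_itv/=; apply/andP; split; lra.
have neg (s : R) : pi / 2 < s -> s <= pi -> cos s < 0.
  move=> s1 s2; rewrite -cos_pihalf ltr_cos// in_itv/=; apply/andP; split; lra.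
have [tp|tp] := ltP (pi / 2) theta.
  have := turn 0; rewrite addr0 => /(_ (lexx _)) H0.
  have := neg _ tp tpi; have : 0 <= cos theta by apply: H0; lra.
  lra.
pose phi := (pi / 2 - theta + kappa / 2) / 2.
have : 0 <= cos (theta + phi) by apply: turn; rewrite /phi; lra.
have : cos (theta + phi) < 0 by apply: neg; rewrite /phi; lra.
lra.
Qed.

(** A direction w of the cone making an obtuse angle with z - x would, to first
    order, bring z closer to x. *)
Lemma cone_directions x z v kappa delta r : 0 < r -> enorm (z - x) = r ->
  (0 < delta)%E ->
  (forall y, cone z v kappa delta y -> r <= enorm (y - x)) ->
  forall w, sphere w -> cos (kappa / 2) < dotv w v -> 0 <= dotv w (z - x).
Proof.
move=> r0 zx d0 C w sw wv; rewrite leNgt; apply/negP => wz.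
pose c := - dotv w (z - x); have c0 : 0 < c by rewrite oppr_gt0.
have [rho [rho0 rhod rhoc]] : exists rho : R, [/\ 0 < rho, (rho%:E < delta)%E & rho <= c].
  case: delta d0 C => [d| |] // d0 _; last by exists c; split=> //; rewrite ltry.
  exists (Num.min (d / 2) c); move: d0; rewrite !lte_fin => d0.
  by split; [rewrite lt_min c0 divr_gt0|rewrite gt_min; apply/orP; left; lra|rewrite ge_min lexx orbT].
have := C (z + rho *: w); rewrite leNgt => /(_ _)/negP; apply.
  by exists rho, w; split.
rewrite -zx -(@ltr_pXn2r _ 2)// ?nnegrE ?enorm_ge0// !sqr_enorm.
have -> : z + rho *: w - x = (z - x) + rho *: w by rewrite addrAC.
move: c0 rhoc; rewrite /c; move: (z - x) => u.
rewrite !dotvE (sphere_dotv sw) (dotvC u w); set t := dotv w u => c0 rhoc.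
have : rho * (rho + t) <= 0 by rewrite pmulr_rle0//; lra.
have : rho * t < 0 by rewrite pmulr_rlt0//; lra.
by move=> *; lra.
Qed.

Lemma orth_cone T x v kappa delta y : orthogonal T ->
  cone (T x) (T v) kappa delta (T y) <-> cone x v kappa delta y.
Proof.
move=> oT; split=> /coneP H; apply/coneP; move: H;
  by rewrite -(orthB y x oT) (orth_enorm _ oT) (orth_dotv oT).
Qed.

Lemma translate_cone t x v kappa delta y :
  cone (x + t) v kappa delta (y + t) <-> cone x v kappa delta y.
Proof.
have E : y + t - (x + t) = y - x by rewrite opprD addrACA subrr addr0.
by split=> /coneP H; apply/coneP; move: H; rewrite E.
Qed.

End cone_geometry.

Section standard_cone.
Context {R : realType} {m : nat}.
Hypothesis m0 : (0 < m)%N.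
Variables (alpha kappa : R) (delta : \bar R) (D : R).
Hypothesis alpha0 : alpha <= 0.
Local Notation k := (@radial_primitive R m alpha).
Local Notation e1 := (unit_vec R m 0).

Definition std_cone theta r := cone_theta theta (r *: e1) kappa delta `&` eball D 0.

Lemma measurable_std_cone theta r : measurable (std_cone theta r).
Proof. by apply: measurableI; [exact: measurable_cone|exact: measurable_eball]. Qed.

Lemma riesz0E (A : set 'rV[R]_m) :
  \int[lebesgue_rV m]_(xi in A) (enorm xi `^ (alpha - m%:R)) = fine (riesz alpha 0 A).
Proof. by apply: eq_Rintegral => xi _; rewrite sub0r enormN. Qed.

(** At a zero r of E, the infimum over theta becomes an inequality for each theta.
    The real-valued integral is 0 when the extended one is infinite, so it is a
    lower bound of the latter in every case. *)
Lemma Efun_eq0_le R0 theta r : 0 < R0 -> R0 <= D ->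
  Efun m alpha kappa delta D R0 r = 0 ->
  0 <= theta <= (pi - kappa) / 2 ->
  ((k D - k R0)%:E <= riesz alpha 0 (std_cone theta r))%E.
Proof.
move=> R00 R0D E0 theta_itv.
have annE : \int[lebesgue_rV m]_(xi in eball D 0 `\` eball R0 0) (enorm xi `^ (alpha - m%:R)) = k D - k R0.
  by rewrite riesz0E -/(annulus R0 D 0) (riesz_annulus m0 alpha0).
have kD : k D - k R0 <= fine (riesz alpha 0 (std_cone theta r)).
  rewrite -subr_ge0 -E0 /Efun annE; apply: ge_inf.
    exists (- (k D - k R0)) => _ [t _ <-]; rewrite lerDr.
    by apply: Rintegral_ge0 => xi _; exact: powR_ge0.
  exists theta; first exact: theta_itv.
  by rewrite (riesz0E (std_cone theta r)).
apply: (@le_trans _ _ (fine (riesz alpha 0 (std_cone theta r)))%:E); first by rewrite lee_fin.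
have := @riesz_ge0 R m alpha 0 (std_cone theta r).
by case: (riesz alpha 0 _).
Qed.

(** The homothety of ratio r / s maps the truncated cone for s into that for r,
    and multiplies the integral by (r / s)^alpha, which is at least 1. *)
Lemma riesz_std_cone_mono theta r s : 0 < r -> r <= s ->
  (riesz alpha 0 (std_cone theta s) <= riesz alpha 0 (std_cone theta r))%E.
Proof.
move=> r0 rs; have s0 := lt_le_trans r0 rs.
pose l := s / r; have l1 : 1 <= l by rewrite ler_pdivlMr// mul1r.
have l0 : 0 < l by lra.
have ms := measurable_std_cone theta s.
apply: (@le_trans _ _ (riesz alpha 0 ((fun y => l *: y) @^-1` std_cone theta s))).
  rewrite (riesz_scale alpha l0 ms) -[leLHS]mul1e.
  apply: lee_wpmul2r; first exact: riesz_ge0.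
  by rewrite lee_fin -(powRr0 l) ler_powR// oppr_ge0.
apply: le_riesz; [|exact: measurable_std_cone|].
  exact: measurable_preimage (measurable_scale l) ms.
move=> y [/coneP[H1 H2 H3] H4].
have E : l *: y - s *: e1 = l *: (y - r *: e1).
  by rewrite scalerBr scalerA /l divfK// gt_eqF.
move: H1 H2 H3; rewrite E enormZ (gtr0_norm l0) dotvZl => H1 H2 H3.
have e0 := enorm_ge0 (y - r *: e1).
split; [apply/coneP; split|].
- by rewrite -(pmulr_rgt0 _ l0).
- by apply: le_lt_trans H2; rewrite lee_fin ler_peMl.
- by rewrite -(ltr_pM2l l0) mulrCA.
- move: H4; rewrite /eball/= !subr0 enormZ (gtr0_norm l0); apply: le_trans.
  by rewrite ler_peMl// enorm_ge0.
Qed.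

End standard_cone.
Arguments std_cone {R} m kappa delta D theta r.

Section inradius.
Context {R : realType} {m : nat}.
Hypothesis m2 : (2 <= m)%N.
Variables (alpha kappa : R) (delta : \bar R) (Omega : set 'rV[R]_m).
Hypothesis kappa_itv : 0 < kappa <= pi.
Hypothesis delta0 : (0 < delta)%E.
Hypothesis bO : body Omega.
Hypothesis coneO : inner_cone_condition (~` Omega) kappa delta.
Implicit Types (x y z n v w : 'rV[R]_m).

Local Notation D := (diam Omega).
Local Notation e1 := (unit_vec R m 0).
Let m0 : (0 < m)%N. Proof. exact: ltnW. Qed.

(** C is the truncated cone, outside Omega, at a boundary point z nearest to x, and
    n is the direction from x to z. Since the cone avoids the ball of radius r
    around x, its directions make no obtuse angle with n; this bounds the angle
    theta between its axis and n by [angle_le]. *)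
Lemma nearest_cone x : Omega° x -> exists (C : set 'rV[R]_m) theta n,
  let r := dist x (~` Omega) in
  [/\ [/\ measurable C, C `<=` eball D x & C `<=` ~` Omega],
      sphere n /\ (forall y, C y -> 0 <= dotv (y - x) n),
      0 <= theta <= (pi - kappa) / 2 &
      riesz alpha x C = riesz alpha 0 (std_cone m kappa delta D theta r)].
Proof.
move=> Ox; have [z [zx Oz bz]] := nearest_boundary m0 bO Ox.
have [v sv Cv] := coneO bz.
set r := dist x _ in zx *; have r0 : 0 < r := dist_gt0 m0 bO Ox.
pose n := r^-1 *: (z - x).
have zE : z - x = r *: n by rewrite /n scalerA mulfV ?scale1r// gt_eqF.
have sn : sphere n.
  by rewrite /sphere/= enormZ zx ger0_norm ?invr_ge0 ?(ltW r0)// mulVf// gt_eqF.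
have Cr y : cone z v kappa delta y -> r <= enorm (y - x).
  by move=> /Cv nOy; rewrite leNgt; apply/negP => yx; apply: nOy;
    apply: (@in_dist_setC _ _ Omega x); rewrite enormB.
have dir w : sphere w -> cos (kappa / 2) < dotv w v -> 0 <= dotv w n.
  move=> sw wv; have := cone_directions r0 zx delta0 Cr sw wv.
  by rewrite zE dotvZr pmulr_rge0.
have se1 : sphere e1 by exact: sphere_unit_vec.
have sem : sphere (unit_vec R m m.-1) by apply: sphere_unit_vec; rewrite ltn_predL.
have e1em : dotv e1 (unit_vec R m m.-1) = 0.
  by rewrite dotv_unit_vec//; case: (m) m2 => [|[|]].
have [T [oT Tn Tv]] := rotation_pair sn sv se1 sem e1em.
set theta := acos _ in Tv.
pose Psi y := T (y - x).
pose C := Psi @^-1` std_cone m kappa delta D theta r.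
have Tz : T (z - x) = r *: e1 by rewrite zE (orthZ oT) Tn.
have CE y : cone_theta theta (r *: e1) kappa delta (Psi y) <-> cone z v kappa delta y.
  rewrite /cone_theta -Tv -Tz /Psi orth_cone//.
  exact: translate_cone.
have mPsi : measurable_fun setT Psi.
  exact: (measurableT_comp (measurable_orth oT) (measurable_addr (- x))).
have PsiE y : enorm (Psi y - 0) = enorm (y - x) by rewrite subr0 (orth_enorm _ oT).
exists C, theta, n; split.
- split; first exact: measurable_preimage mPsi (@measurable_std_cone R m kappa delta D theta r).
    by move=> y [_]; rewrite /eball/= PsiE.
  by move=> y [/CE/Cv].
- split=> // y [/CE [rho [w [rho0 _ sw wv ->]]] _].
  rewrite addrAC zE dotvDl (dotvZl r) (dotvZl rho).
  by apply: addr_ge0; apply: mulr_ge0; [exact: ltW|exact: dotv_ge0|exact: ltW|exact: dir].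
- have t_itv : 0 <= theta <= pi.
    have : -1 <= dotv n v <= 1.
      have := cauchy_schwarz (- n) v; have := cauchy_schwarz n v.
      by rewrite enormN (sn : _ = _) (sv : _ = _) mulr1 dotvNl => ? ?; apply/andP; split; lra.
    by move=> nv; rewrite acos_ge0// acos_lepi.
  have /andP[-> _] := t_itv; apply: (angle_le m2 t_itv kappa_itv) => w sw.
  have [S TS ST] := orth_inv oT.
  rewrite -Tv -Tn -(ST w) !(orth_dotv oT); apply: dir.
  by rewrite /sphere/= (orth_enorm _ (orth_inverse oT TS ST)).
- have mS := @measurable_std_cone R m kappa delta D theta r.
  have mT := measurable_preimage (measurable_orth oT) mS.
  apply: (etrans (riesz_translate alpha (- x) x mT)).
  by rewrite subrr (riesz_orth alpha 0 oT mS) (orth0 oT).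
Qed.

End inradius.

(** * Lower bound for the distance to the complement *)

Section final.
Context {R : realType} {m : nat}.
Hypothesis m2 : (2 <= m)%N.
Variables (alpha kappa : R) (delta : \bar R) (Omega : set 'rV[R]_m).
Hypothesis alpha0 : alpha <= 0.
Hypothesis kappa_itv : 0 < kappa <= pi.
Hypothesis delta0 : (0 < delta)%E.
Hypothesis bO : body Omega.
Hypothesis coneO : inner_cone_condition (~` Omega) kappa delta.
Implicit Types (x y z n v w : 'rV[R]_m).

Local Notation k := (@radial_primitive R m alpha).
Local Notation D := (diam Omega).
Local Notation R0 := (inradius Omega).
Let m0 : (0 < m)%N. Proof. exact: ltnW. Qed.
Let alpham : alpha <= m%:R. Proof. by rewrite (le_trans alpha0). Qed.

Lemma potential_ge y s : 0 < s -> eball s y `<=` Omega ->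
  k s <= potential alpha Omega y.
Proof.
move=> s0 sO; have [M OM] := body_bounded bO.
rewrite (potentialE m0 alpha0 (body_measurable bO) (bounded_eball y OM) s0 sO).
by rewrite lerDr fine_ge0// riesz_ge0.
Qed.

(** By continuity of the primitive, as balls of radius arbitrarily close to the
    inradius are contained in Omega. *)
Lemma center_potential_ge x : is_center alpha Omega x -> 0 < R0 ->
  k R0 <= potential alpha Omega x.
Proof.
move=> [Ox xmax] R00; have OOx := interior_subset Ox.
rewrite leNgt; apply/negP => xk.
have [d d0 dk] : exists2 d, 0 < d & forall s, `|R0 - s| < d -> potential alpha Omega x < k s.
  have := radial_primitive_continuous m0 alpha0 R00.
  move=> /cvgr_gt/(_ _ xk)/nbhs_ballP[d d0 dk]; by exists d.
pose s := R0 - Num.min (d / 2) (R0 / 2).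
have [e0 ed eR] : [/\ 0 < Num.min (d / 2) (R0 / 2),
    Num.min (d / 2) (R0 / 2) <= d / 2 & Num.min (d / 2) (R0 / 2) <= R0 / 2].
  by rewrite lt_min !ge_min !lexx orbT !divr_gt0.
have s0 : 0 < s by rewrite /s; lra.
have [y yO] : exists y, eball s y `<=` Omega.
  by apply: (inradius_adherent m0 bO OOx); rewrite /s; lra.
have Oy : Omega° y by apply/nbhs_eballP; exists s.
have : potential alpha Omega x < k s.
  by apply: dk; rewrite /s subKr gtr0_norm//; lra.
by rewrite ltNge (le_trans (potential_ge s0 yO) (xmax _ Oy)).
Qed.

(** The potential at x is at most that of the ball of radius D around x minus
    what is lost on a set C outside Omega. The loss is strict: the part of this
    ball close to the point x - D n is also missed, since Omega has points
    on the opposite side of x. *)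
Lemma potential_lt x n (C : set 'rV[R]_m) : Omega° x -> sphere n ->
  measurable C -> C `<=` eball D x -> C `<=` ~` Omega ->
  (forall y, C y -> 0 <= dotv (y - x) n) ->
  ((potential alpha Omega x)%:E + riesz alpha x C < (k D)%:E)%E.
Proof.
move=> Ox sn mC CD CO Cn; have OOx := interior_subset Ox.
have mO := body_measurable bO.
set r := dist x (~` Omega); have r0 : 0 < r := dist_gt0 m0 bO Ox.
have rD : r <= D := dist_le_diam m0 bO OOx.
have OD : Omega `<=` eball D x by move=> y Oy; exact: enorm_le_diam.
pose e := r / 2.
have e0 : 0 < e by rewrite /e; lra.
have eO : eball e x `<=` Omega.
  move=> y xy; apply: (@in_dist_setC _ _ Omega x); rewrite -/r enormB.
  by apply: le_lt_trans xy _; rewrite /e; lra.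
have mOe : measurable (Omega `\` eball e x).
  by apply: measurableD => //; exact: measurable_eball.
(* Any point of Q has distance at least D + r / 4 to the point x + (r / 2) n of
   Omega, hence is outside Omega. *)
pose q := x - (D - r / 8) *: n.
pose Q := eball (r / 8) q.
have mQ : measurable Q by exact: measurable_eball.
have QD : Q `<=` eball D x.
  move=> y; rewrite /Q /eball/= => yq; have := ler_enormB y q x.
  rewrite /q addrAC subrr sub0r enormN enormZ (sn : _ = _) mulr1 ger0_norm; lra.
have QO : Q `<=` ~` Omega.
  move=> y yq Oy; pose p := x + (r / 2) *: n.
  have Op : Omega p.
    apply: eO; rewrite /eball/= /p addrC addKr enormZ (sn : _ = _) mulr1.
    by rewrite gtr0_norm// /e; lra.
  have := enorm_le_diam bO Op Oy; have := ler_enormB p y q.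
  move: yq; rewrite /Q /eball/=.
  have -> : p - q = (D + r * (3 / 8)) *: n.
    rewrite /p /q opprD opprK addrACA subrr add0r -scalerDl; congr (_ *: _); lra.
  rewrite enormZ (sn : _ = _) mulr1 ger0_norm; lra.
have QC : C `&` Q = set0.
  apply/seteqP; split=> // y [/Cn yn]; rewrite /Q /eball/= => yq.
  have := cauchy_schwarz (y - q) n; rewrite (sn : _ = _) mulr1.
  have -> : y - q = (y - x) + (D - r / 8) *: n by rewrite /q opprB addrCA addrC.
  rewrite dotvDl dotvZl (sphere_dotv sn).
  rewrite (_ : y - x + _ = y - q); last by rewrite /q opprB addrCA addrC.
  lra.
have CQO : (Omega `\` eball e x) `&` (C `|` Q) = set0.
  by apply/seteqP; split=> // y [[Oy _] [/CO|/QO]].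
have hole_fin := riesz_hole_fin alpha0 mO OD e0.
have Ce y : (C `|` Q) y -> e <= enorm (x - y) <= D.
  move=> CQy; apply/andP; split; last first.
    by rewrite enormB; case: CQy => [/CD|/QD].
  rewrite leNgt enormB; apply/negP => ye.
  by case: CQy => [/CO|/QO]; apply; apply: eO; exact: ltW.
have Qpos : (0 < riesz alpha x Q)%E.
  apply: (@riesz_gt0 _ _ _ alpham x Q e D q) => //.
    by move=> y Qy; apply: Ce; right.
  by apply/nbhs_eballP; exists (r / 8) => //; lra.
have Qfin : riesz alpha x Q \is a fin_num.
  by apply: (@riesz_fin _ _ _ alpham x Q e D) => // y Qy; apply: Ce; right.
have Cfin : riesz alpha x C \is a fin_num.
  by apply: (@riesz_fin _ _ _ alpham x C e D) => // y Qy; apply: Ce; left.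
have : (riesz alpha x ((Omega `\` eball e x) `|` (C `|` Q)) <= (k D - k e)%:E)%E.
  have eD : e <= D by rewrite /e; lra.
  rewrite -(riesz_annulus m0 alpha0 x e0 eD).
  apply: le_riesz; [|exact: measurable_annulus|].
    by apply: measurableU => //; exact: measurableU.
  move=> y [[Oy yx]|CQy].
    by split=> //; exact: OD.
  split; first by case: CQy => [/CD|/QD].
  by move=> /eO; case: CQy => [/CO|/QO].
rewrite riesz_setU//; last exact: measurableU.
rewrite riesz_setU// (potentialE m0 alpha0 mO OD e0 eO).
move: Qpos; rewrite -(fineK hole_fin) -(fineK Qfin) -(fineK Cfin) /=.
rewrite -!EFinD !lee_fin !lte_fin /=; lra.
Qed.

Lemma center_inradius x : is_center alpha Omega x ->
  Rtilde m alpha kappa delta D R0 <= dist x (~` Omega).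
Proof.
move=> cx; have [Ox xmax] := cx; have OOx := interior_subset Ox.
set r := dist x _; have r0 : 0 < r := dist_gt0 m0 bO Ox.
rewrite /Rtilde; set P := [set s | _].
have [[s Ps]|nP] := pselect (exists s, P s); last first.
  (* without a positive zero, [get] returns the default value 0 *)
  rewrite xgetPN; first exact: ltW.
  by move=> s Ps; apply: nP; exists s.
have [t0 Et] : P (get P) by apply: getPex; exists s.
set t := get P in t0 Et *; rewrite leNgt; apply/negP => rt.
have R00 : 0 < R0 by apply: lt_le_trans r0 _; exact: dist_le_inradius.
have R0D : R0 <= D := inradius_le_diam m0 bO OOx.
have [C [theta [n /= [[mC CD CO] [sn Cn] theta_itv CE]]]] :=
  nearest_cone m2 alpha kappa_itv delta0 bO coneO Ox.
have := potential_lt Ox sn mC CD CO Cn; rewrite CE.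
have := riesz_std_cone_mono (m := m) kappa delta D alpha0 theta r0 (ltW rt).
have := Efun_eq0_le m0 alpha0 R00 R0D Et theta_itv.
rewrite -/r => H1 H2; apply/negP; rewrite -leNgt.
apply: (@le_trans _ _ ((k R0)%:E + (k D - k R0)%:E)%E); first by rewrite -EFinD lee_fin; lra.
by apply: leeD; [rewrite lee_fin center_potential_ge|exact: (le_trans H1 H2)].
Qed.
End final.

Unset Implicit Arguments.

Theorem corollary3p4 (R : realType) (m : nat) (alpha kappa : R)
    (delta : \bar R) (Omega : set 'rV[R]_m) :
  (2 <= m)%N ->
  alpha <= 0 ->
  0 < kappa <= pi ->
  (0 < delta)%E ->
  body Omega ->
  inner_cone_condition (~` Omega) kappa delta ->
  forall x : 'rV[R]_m, is_center alpha Omega x ->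
    (inner_parallel
       (Rtilde m alpha kappa delta (diam Omega) (inradius Omega)) Omega
     `&` Uf Omega) x.
Proof.
move=> m2 alpha0 kappa_itv delta0 bO coneO x cx.
have [Ox _] := cx; split; last exact: (center_Uf (ltnW m2) alpha0 bO cx).
split; first exact: interior_subset.
exact: (center_inradius m2 alpha0 kappa_itv delta0 bO coneO cx).
Qed.
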